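(* Let $d\in\mathbb{N}$ be fixed and let $\Gamma$ be a real $d\times d$ matrix. For every $n\in\mathbb{N}$ let $X_{n1},\ldots,X_{nn}$ be i.i.d. random vectors in $\mathbb{R}^d$ with $\mathbb{E}[X_{n1}]=0$ and $\mathbb{E}[\|X_{n1}\|^2]<\infty$. Suppose that, as $n\to\infty$, $$\mathrm{Cov}[X_{n1}]\to\Gamma$$ and $$L_n(\epsilon):=\mathbb{E}\big[\|X_{n1}\|^2\,1_{\{\|X_{n1}\|>\sqrt{n}\,\epsilon\}}\big]\to 0\quad\text{for all positive rational }\epsilon.$$ Then $\overline{X}_n:=n^{-1}\sum_{i=1}^n X_{ni}$ satisfies the limit law $$V_n:=n\|\overline{X}_n\|^2\stackrel{\mathcal{D}}{\longrightarrow}V=\sum_{i=1}^d\lambda_iN_i^2,$$ where $\lambda_1,\ldots,\lambda_d$ are the eigenvalues of $\Gamma$ and $N_1,\ldots,N_d$ are i.i.d. standard normal random variables. This is equivalent to $$\sup_{x\in\mathbb{R}}|\mathbb{P}(V_n\le x)-F(x)|\to 0,\quad n\to\infty,$$ where $F$ is the distribution function of $V$.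
   Context: $\|\cdot\|$ is the Euclidean norm on $\mathbb{R}^d$; $\mathrm{Cov}[X]$ is the covariance matrix of a random vector $X$; convergence of matrices is entrywise; $\stackrel{\mathcal{D}}{\to}$ denotes convergence in distribution. Eigenvalues are listed with multiplicity. Independence is only required within each row $n$.
   Formalization: The equivalence with uniform convergence of the distribution functions is asserted only for Γ ≠ 0; for Γ = 0 it fails (X_ni ~ N(0, I/n) gives P(V_n ≤ 0) = 0 but F(0) = 1). The limit law itself is proved for every Γ. *)

(* Defs.v *)
From HB Require Import structures.
From mathcomp Require Import all_boot all_order all_algebra.
From mathcomp Require Import all_classical all_reals all_analysis.

Set Implicit Arguments.
Unset Strict Implicit.
Unset Printing Implicit Defensive.

Import Order.TTheory GRing.Theory Num.Theory.
Import numFieldNormedType.Exports.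

Local Open Scope classical_set_scope.
Local Open Scope ring_scope.

(* The norm `|x| that the library puts on 'rV[R]_d is the sup norm. *)
Definition enorm (R : realType) (d : nat) (x : 'rV[R]_d) : R :=
  Num.sqrt (\sum_(j < d) x ord0 j ^+ 2).

(* R^d with its Borel sigma-algebra; convertible to 'rV[R]_d. *)
Notation borel_rV R d := (g_sigma_algebraType (@open 'rV[R]_d)).

Definition rv_coord (R : realType) (d : nat) (T : Type)
  (X : T -> 'rV[R]_d) (j : 'I_d) : T -> R := fun w => X w ord0 j.

Definition same_distribution (R : realType) (dT dU : measure_display)
    (T : measurableType dT) (U : measurableType dU) (P : probability T R)
    (X Y : {RV P >-> U}) :=
  forall A : set U, measurable A -> distribution P X A = distribution P Y A.

Definition independent (R : realType) (dT dU : measure_display)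
    (T : measurableType dT) (U : measurableType dU) (P : probability T R)
    (I : finType) (X : I -> {RV P >-> U}) :=
  forall (J : {set I}) (A : I -> set U), (forall i, measurable (A i)) ->
    P (\bigcap_(i in [set` J]) (X i @^-1` A i)) =
    (\prod_(i in J) P (X i @^-1` A i))%E.

Definition iid (R : realType) (dT dU : measure_display)
    (T : measurableType dT) (U : measurableType dU) (P : probability T R)
    (I : finType) (X : I -> {RV P >-> U}) :=
  independent X /\ forall i j : I, same_distribution (X i) (X j).

Definition standard_normal (R : realType) (dT : measure_display)
    (T : measurableType dT) (P : probability T R) (X : {RV P >-> R}) :=
  forall A : set R, measurable A -> distribution P X A = normal_prob 0 1 A.

Definition cov_mx (R : realType) (dT : measure_display)
    (T : measurableType dT) (P : probability T R) (d : nat)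
    (X : T -> 'rV[R]_d) : 'M[R]_d :=
  \matrix_(j, k) fine (covariance P (rv_coord X j) (rv_coord X k)).

(* Eigenvalues with (algebraic) multiplicity. *)
Definition eigenvalues (R : realType) (d : nat) (A : 'M[R]_d)
    (lambda : 'I_d -> R) :=
  char_poly A = \prod_(i < d) ('X - (lambda i)%:P).

(* The library's [cdf] takes a bundled random variable and is \bar R-valued. *)
Definition dist_fun (R : realType) (dT : measure_display)
    (T : measurableType dT) (P : probability T R) (V : T -> R) (x : R) : R :=
  fine (P [set w | V w <= x]).

(* Convergence in distribution, in terms of distribution functions:
   pointwise convergence at the continuity points of the limit. *)
Definition cvg_in_distribution (R : realType) (F_ : nat -> R -> R) (F : R -> R) :=
  forall x : R, {for x, continuous F} -> F_ n x @[n --> \oo] --> F x.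

Definition cvg_sup_dist (R : realType) (F_ : nat -> R -> R) (F : R -> R) :=
  sup (range (fun x : R => `|F_ n x - F x|)) @[n --> \oo] --> (0 : R).

(* E[ ||X||^2 1_{||X|| > c} ] *)
Definition truncated_moment2 (R : realType) (dT : measure_display)
    (T : measurableType dT) (P : probability T R) (d : nat)
    (X : T -> 'rV[R]_d) (c : R) : \bar R :=
  ('E_P[fun w =>
     (enorm (X w) ^+ 2 * \1_[set w' | c < enorm (X w')] w)%R])%E.

(* Rows are 1-based: X 1, ..., X n are the vectors of row n. *)
Definition row_mean (R : realType) (d : nat) (T : Type) (n : nat)
    (X : nat -> T -> 'rV[R]_d) : T -> 'rV[R]_d :=
  fun w => n%:R^-1 *: \sum_(1 <= i < n.+1) X i w.

Definition row_stat (R : realType) (d : nat) (T : Type) (n : nat)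
    (X : nat -> T -> 'rV[R]_d) : T -> R :=
  fun w => n%:R * enorm (row_mean n X w) ^+ 2.

(* Main.v *)
(* Rotating the vectors by an orthogonal matrix that diagonalizes Gamma keeps
   their norms, so Gamma may be taken diagonal with entries mu_j >= 0. Since V_n
   and V are nonnegative, it suffices to show the convergence of the Laplace
   transforms E exp(- s V_n / 2) to prod_j (1 + s mu_j)^(-1/2), which is the
   Laplace transform of V and only depends on the characteristic polynomial of
   Gamma.
   The function v(t, x) = E exp(- s |x + G_t|^2 / 2), with G_t normal of
   covariance t diag(mu), is an explicit Gaussian solution of the heat equation
   v_t = 1/2 sum_j mu_j v_(x_j x_j). A second order Taylor expansion in x and in t
   together with the Lindeberg condition gives, uniformly in t and x,
   E v(t, x + X_n1 / sqrt n) = v(t + 1/n, x) + o(1/n), and iterating this over the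
   n independent summands turns E v(0, S_n) into v(1, 0) + o(1), where
   S_n = n^(-1/2) sum_i X_ni.
   If Gamma <> 0, some lambda_i is positive, V has no atom by conditioning on the
   other N_j, and pointwise convergence to a continuous distribution function is
   uniform. *)
Require Import Defs.
From HB Require Import structures.
From mathcomp Require Import all_boot all_order all_algebra.
From mathcomp Require Import all_classical all_reals all_analysis.
From mathcomp Require complex.
From mathcomp Require Import measurable_realfun ring lra.

Set Implicit Arguments.
Unset Strict Implicit.
Unset Printing Implicit Defensive.

Import Order.TTheory GRing.Theory Num.Theory.
Import numFieldNormedType.Exports.

Local Open Scope classical_set_scope.
Local Open Scope ring_scope.

(** * Real spectral theorem *)

Section real_spectral.
Import complex.

(** Gaussian functions are closed under convolution with normal laws. With the test function exp(- s
    |x|^2 / 2) the Gaussian side of the comparison is therefore a formula, from which the heat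
    equation and all derivatives are read off; no normal vectors have to be added to the sums. Two
    demands shape the estimates. The point [x] will be a random partial sum, so the error of a step
    must not depend on [x]: the derivatives of [v] are dominated by polynomials in the exponent q
    times exp(- q), and q exp(- q) and q^2 exp(- q) are bounded. Third moments may be infinite, so
    the remainder for an increment y has the form |y|^2 min(1, |y|) up to constants: the third
    derivative serves small increments, the second one serves large increments, whose share is the
    truncated moment. The passage from Laplace transforms to distribution functions is elementary:
    polynomials in exp(- V) approximate the indicator of V <= x, and their expectations are finite
    combinations of Laplace transforms at integers. *)

Lemma mulmx_trr_gt0 (R : realFieldType) n (u : 'rV[R]_n) :
  u != 0 -> 0 < (u *m u^T) ord0 ord0.
Proof.
move=> u0; rewrite mxE lt_def sumr_ge0 ?andbT; last first.
  by move=> i _; rewrite mxE -expr2 sqr_ge0.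
apply: contraNneq u0 => /eqP u0; apply/eqP/rowP => j; rewrite mxE.
move: u0; rewrite psumr_eq0; last by move=> i _; rewrite mxE -expr2 sqr_ge0.
by move=> /allP/(_ j (mem_index_enum _)); rewrite mxE -expr2 sqrf_eq0 => /eqP.
Qed.

(** Over the complex numbers the characteristic polynomial has a root z, with eigenvector a + i b.
    Symmetry gives a A b^T = b A a^T, that is, Im z (|a|^2 + |b|^2) = 0. So z is real, and whichever
    of a, b is nonzero is a real eigenvector. *)
Lemma symmetric_eigenvalue (R : rcfType) n (A : 'M[R]_n.+1) :
  A^T = A -> exists a, eigenvalue A a.
Proof.
move=> sA; pose C : closedFieldType := R[i].
pose AC := map_mx (real_complex R) A.
have /closed_rootP[z] : size (char_poly AC) != 1%N by rewrite size_char_poly.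
rewrite -eigenvalue_root_char => /eigenvalueP[v /rowP vA v0].
pose a : 'rV[R]_n.+1 := map_mx (@complex.Re R) v.
pose b : 'rV[R]_n.+1 := map_mx (@complex.Im R) v.
have aA : a *m A = complex.Re z *: a - complex.Im z *: b.
  apply/rowP => j; have := congr1 (@complex.Re R) (vA j).
  rewrite !mxE raddf_sum /= => e.
  transitivity (\sum_j0 complex.Re (v 0 j0 * AC j0 j)).
    by apply: eq_bigr => k _; rewrite !mxE; case: (v 0 k) => x y /=; ring.
  by rewrite e; case: (z) (v 0 j) => x y [x' y'].
have bA : b *m A = complex.Re z *: b + complex.Im z *: a.
  apply/rowP => j; have := congr1 (@complex.Im R) (vA j).
  rewrite !mxE raddf_sum /= => e.
  transitivity (\sum_j0 complex.Im (v 0 j0 * AC j0 j)).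
    by apply: eq_bigr => k _; rewrite !mxE; case: (v 0 k) => x y /=; ring.
  by rewrite e; case: (z) (v 0 j) => x y [x' y'] /=; ring.
have ab0 : (a != 0) || (b != 0).
  rewrite -negb_and; apply: contraNN v0 => /andP[/eqP/rowP a0 /eqP/rowP b0].
  apply/eqP/rowP => j; move: (a0 j) (b0 j); rewrite !mxE.
  by case: (v 0 j) => x y /= -> ->.
have tr11 (M : 'M[R]_1) : M^T = M.
  by apply/matrixP => i j; rewrite !mxE !ord1.
have abE : a *m A *m b^T = b *m A *m a^T.
  by rewrite -[LHS]tr11 !trmx_mul trmxK sA mulmxA.
have z0 : complex.Im z = 0.
  move: abE; rewrite aA bA mulmxBl mulmxDl -!scalemxAl.
  rewrite -[a *m b^T]tr11 trmx_mul trmxK => /eqP.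
  rewrite addrC [X in _ == X]addrC (inj_eq (addIr _)) -subr_eq0 -opprD oppr_eq0.
  rewrite -scalerDr scaler_eq0 => /orP[/eqP//|/eqP/matrixP/(_ 0 0)].
  rewrite [LHS]mxE => e0; exfalso; move: e0; rewrite [RHS]mxE.
  have pos (u : 'rV[R]_n.+1) : 0 <= (u *m u^T) ord0 ord0.
    have [->|/mulmx_trr_gt0/ltW//] := eqVneq u 0.
    by rewrite mul0mx mxE.
  case/orP: ab0 => /mulmx_trr_gt0; have := pos a; have := pos b; lra.
rewrite z0 !scale0r ?subr0 ?addr0 in aA bA.
exists (complex.Re z); apply/eigenvalueP.
by case/orP: ab0; [exists a|exists b].
Qed.

(* The Householder reflection along e_0 - u. *)
Lemma reflection_to_unit (R : realFieldType) n (u : 'rV[R]_n.+1) :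
  u *m u^T = 1%:M ->
  exists H : 'M[R]_n.+1, [/\ H^T = H, H *m H = 1%:M & delta_mx 0 0 *m H = u].
Proof.
move=> uu; pose e : 'rV[R]_n.+1 := delta_mx 0 0.
have ee : e *m e^T = 1%:M.
  by rewrite /e trmx_delta mul_delta_mx; apply/matrixP => i j; rewrite !ord1 !mxE.
pose w := e - u; have [w0|w0] := eqVneq w 0.
  exists 1%:M; split; rewrite ?trmx1 ?mulmx1 //.
  by apply/eqP; rewrite -subr_eq0 -/w w0.
have eu : e *m u^T = (u 0 0)%:M.
  by rewrite /e -rowE; apply/matrixP => i j; rewrite !ord1 !mxE eqxx.
have ue : u *m e^T = (u 0 0)%:M.
  by rewrite -[LHS]trmxK trmx_mul trmxK eu tr_scalar_mx.
have ewE : e *m w^T = (1 - u 0 0)%:M.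
  by rewrite /w linearB /= mulmxBr ee eu -raddfB.
have ww : w *m w^T = (2 * (1 - u 0 0))%:M.
  rewrite {1}/w mulmxBl ewE /w linearB /= mulmxBr ue uu.
  by rewrite -!raddfB; congr (_%:M); ring.
have c0 : 1 - u 0 0 != 0.
  have := mulmx_trr_gt0 w0; rewrite ww mxE eqxx mulr1n => h.
  by apply/eqP => h'; move: h; rewrite h' mulr0 ltxx.
(* As e_0 and u are unit vectors, |w|^2 = 2 (1 - u_0), so the coefficient is the usual 2 / |w|^2. *)
exists (1%:M - (1 - u 0 0)^-1 *: (w^T *m w)); split.
- by rewrite linearB /= trmx1 linearZ /= trmx_mul trmxK.
- set x := 1 - u 0 0 in ww c0 *; set W := w^T *m w.
  have WW : W *m W = (2 * x) *: W.
    by rewrite /W mulmxA -(mulmxA w^T) ww mul_mx_scalar -scalemxAl.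
  rewrite mulmxBl mul1mx -scalemxAl mulmxBr mulmx1 -scalemxAr WW scalerBr.
  rewrite !scalerA (_ : x^-1 / x * (2 * x) = 2 * x^-1); last by field.
  by rewrite mulr_natl mulr2n scalerDl opprB addrK subrK.
- rewrite mulmxBr mulmx1 -scalemxAr mulmxA ewE mul_scalar_mx scalerA mulVf //.
  by rewrite scale1r /w opprB addrC subrK.
Qed.

(** Deflation: a reflection [H] takes e_0 to a unit eigenvector, so the first row of H A H is a
    multiple of e_0. By symmetry so is the first column, and the induction hypothesis diagonalizes
    the remaining block. *)
Lemma symmetric_spectral (R : rcfType) n (A : 'M[R]_n) : A^T = A ->
  exists (Q : 'M[R]_n) (D : 'rV[R]_n),
    Q *m Q^T = 1%:M /\ Q *m A *m Q^T = diag_mx D.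
Proof.
elim: n A => [|n IH] A sA.
  by exists 1%:M, 0; split; apply/matrixP => -[].
have [a /eigenvalueP[u0 u0A u0n]] := symmetric_eigenvalue sA.
have u0p := mulmx_trr_gt0 u0n.
pose c := Num.sqrt ((u0 *m u0^T) 0 0).
have c0 : c != 0 by rewrite gt_eqF // sqrtr_gt0.
pose u := c^-1 *: u0.
have uA : u *m A = a *: u by rewrite -scalemxAl u0A scalerA mulrC -scalerA.
have uu : u *m u^T = 1%:M.
  apply/matrixP => i j; rewrite !ord1 /u linearZ /= -scalemxAl -scalemxAr scalerA.
  rewrite mxE -invfM -expr2 sqr_sqrtr ?(ltW u0p)// mulVf ?(gt_eqF u0p)//.
  by rewrite mxE eqxx.
have [H [sH HH eH]] := reflection_to_unit uu.
pose B : 'M[R]_(1 + n) := H *m A *m H.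
have sB : B^T = B by rewrite /B !trmx_mul sH sA mulmxA.
have row0B : delta_mx 0 0 *m (H *m A *m H) = a *: delta_mx 0 0 :> 'rV_n.+1.
  rewrite !mulmxA eH uA -scalemxAl; congr (_ *: _).
  by rewrite -eH -mulmxA HH mulmx1.
have urB : ursubmx B = 0.
  apply/matrixP => i j; rewrite !ord1.
  have := congr1 (fun M : 'rV_n.+1 => M 0 (rshift 1 j)) row0B.
  rewrite -rowE mxE => e; transitivity (B 0 (rshift 1 j)).
    by rewrite [LHS]mxE [LHS]mxE; congr (B _ _); apply/val_inj.
  by rewrite [LHS]e !mxE /= mulr0.
have dlB : dlsubmx B = 0.
  by rewrite -sB -trmx_ursub urB trmx0.
have sB' : (drsubmx B)^T = drsubmx B by rewrite trmx_drsub sB.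
have [Q' [D' [QQ' QBQ']]] := IH _ sB'.
pose Q1 : 'M[R]_(1 + n) := block_mx 1%:M 0 0 Q'.
have sQ1 : Q1^T = block_mx 1%:M 0 0 Q'^T by rewrite tr_block_mx !trmx0 trmx1.
have Q1Q1 : Q1 *m Q1^T = 1%:M.
  rewrite sQ1 mulmx_block !mul0mx !mulmx0 !addr0 add0r mulmx1 QQ'.
  by rewrite -scalar_mx_block.
pose E : 'rV_1 := ulsubmx B.
exists (Q1 *m H), (row_mx E D' : 'rV_(1 + n)); split.
  by rewrite trmx_mul sH mulmxA -(mulmxA Q1) HH mulmx1.
transitivity (Q1 *m B *m Q1^T).
  by rewrite trmx_mul sH /B !mulmxA.
rewrite -(submxK B) urB dlB sQ1 !mulmx_block !(mul0mx, mulmx0, addr0, add0r).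
rewrite QBQ' mulmx1 mul1mx.
have DE : diag_mx E = E.
  by apply/matrixP => i j; rewrite !ord1 !mxE eqxx mulr1n.
have := esym (diag_mx_row E D'); rewrite DE => eD.
exact: eD.
Qed.

End real_spectral.

(** * Taylor expansion of exp(- f) *)

Section taylor.
Context {R : realType}.
Implicit Types f E q : R -> R.

Lemma MVT_is_derive f f' (a b : R) : a < b ->
  (forall t : R, t \in `[a, b] -> is_derive t 1 f (f' t)) ->
  exists2 c, c \in `]a, b[ & f b - f a = f' c * (b - a).
Proof.
move=> ab df; have H (x : R) : x \in `]a, b[ -> is_derive x 1 f (f' x).
  by move=> xab; apply: df; rewrite in_itv /= !ltW // (itvP xab).
apply: (@MVT R f f' a b ab H); apply: derivable_within_continuous => x xab.
by have dfx := df x xab; exact: ex_derive.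
Qed.

(** Lagrange's form of the remainder. [K] is chosen such that the auxiliary [g] vanishes at both
    ends; the mean value theorem for [g] gives the point. *)
Lemma taylor2 f f' f'' :
  (forall t : R, t \in `[0, 1] -> is_derive t 1 f (f' t)) ->
  (forall t : R, t \in `[0, 1] -> is_derive t 1 f' (f'' t)) ->
  exists2 x, x \in `]0, 1[ & f 1 = f 0 + f' 0 + f'' x / 2.
Proof.
move=> df df'.
pose K := f 1 - f 0 - f' 0.
pose g t := f 1 - f t - f' t * (1 - t) - K * (1 - t) ^+ 2.
pose g' t := - (f'' t * (1 - t)) + 2 * K * (1 - t).
have dg (t : R) : t \in `[0, 1] -> is_derive t 1 g (g' t).
  move=> t01; have dft := df _ t01; have dft' := df' _ t01.
  rewrite /g; apply: is_derive_eq; rewrite /g' /GRing.scale /=; ring.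
have [x x01] := MVT_is_derive ltr01 dg.
rewrite /g /g' /K => e; exists x => //.
have : 1 - x != 0 by rewrite subr_eq0 gt_eqF // (itvP x01).
move=> x1; apply: (mulIf x1); move: e; rewrite !subrr !subr0 !mulr0 !mulr1.
move=> e; lra.
Qed.

(** The second derivative of exp(- f) is (f'^2 - f'') exp(- f); the factor 1/2 of the remainder is
    given away. This serves the expansion in time. *)
Lemma taylor_expRN f f' f'' (M : R) :
  (forall t : R, t \in `[0, 1] -> is_derive t 1 f (f' t)) ->
  (forall t : R, t \in `[0, 1] -> is_derive t 1 f' (f'' t)) ->
  (forall t : R, t \in `[0, 1] -> `|f' t ^+ 2 - f'' t| * expR (- f t) <= M) ->
  `|expR (- f 1) - expR (- f 0) * (1 - f' 0)| <= M.
Proof.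
move=> df df' bM.
pose g t := expR (- f t); pose g' t := - f' t * expR (- f t).
pose g'' t := (f' t ^+ 2 - f'' t) * expR (- f t).
have dg (t : R) : t \in `[0, 1] -> is_derive t 1 g (g' t).
  move=> t01; have dft := df _ t01.
  apply: is_derive_eq; rewrite /g' /GRing.scale /=; ring.
have dg' (t : R) : t \in `[0, 1] -> is_derive t 1 g' (g'' t).
  move=> t01; have dft := df _ t01; have dft' := df' _ t01.
  apply: is_derive_eq; rewrite /g'' /GRing.scale /=; ring.
have [x x01 e] := taylor2 dg dg'.
rewrite -[expR (- f 1)]/(g 1) e.
rewrite (_ : _ - _ = g'' x / 2); last by rewrite /g /g'; ring.
have x01' : x \in `[0, 1] by rewrite in_itv /= !ltW // (itvP x01).
rewrite normrM (ger0_norm (_ : 0 <= 2^-1)) // /g'' normrM.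
rewrite (gtr0_norm (expR_gt0 _)).
have := bM _ x01'; have := normr_ge0 (f' x ^+ 2 - f'' x).
have := expR_gt0 (- f x); nra.
Qed.

Lemma mul_expRN_le1 (x : R) : x * expR (- x) <= 1.
Proof.
rewrite expRN ler_pdivrMr ?expR_gt0 // mul1r.
by apply: le_trans (expR_ge1Dx x); rewrite lerDr.
Qed.

(** The preceding bound at x/2, squared. *)
Lemma mul_sqr_expRN_le4 (x : R) : 0 <= x -> x ^+ 2 * expR (- x) <= 4.
Proof.
move=> x0; have := @mul_expRN_le1 (x / 2).
have -> : - x = - (x / 2) + - (x / 2) by lra.
rewrite expRD; have := expR_gt0 (- (x / 2)).
set e := expR _ => e0 h; have : (x / 2 * e) ^+ 2 <= 1.
  by rewrite expr_le1 // mulr_ge0 ?divr_ge0 // ltW.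
by rewrite exprMn expr_div_n; lra.
Qed.

(* q is the exponent along a line, so that q' = p + r t and q'' = r. *)
Lemma taylor_gaussian (q0 p r rho : R) : 0 <= rho -> r = rho ^+ 2 ->
  let q t := q0 + p * t + r * t ^+ 2 / 2 in
  (forall t : R, 0 <= t <= 1 -> (p + r * t) ^+ 2 <= 2 * r * q t) ->
  (forall t : R, 0 <= t <= 1 -> 0 <= q t) ->
  `|expR (- q 1) - expR (- q0) * (1 - p + (p ^+ 2 - r) / 2)|
    <= 20 * r * Num.min 1 rho.
Proof.
move=> rho0 rE q CS q0'.
pose g t := expR (- q t); pose g' t := - (p + r * t) * expR (- q t).
pose g'' t := ((p + r * t) ^+ 2 - r) * expR (- q t).
pose g3 t := (3 * (p + r * t) * r - (p + r * t) ^+ 3) * expR (- q t).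
have r0 : 0 <= r by rewrite rE sqr_ge0.
have dq (t : R) : is_derive t 1 q (p + r * t).
  by apply: is_derive_eq; rewrite /GRing.scale /=; field.
have dg (t : R) : is_derive t 1 g (g' t).
  apply: is_derive_eq; rewrite /g' /GRing.scale /=; ring.
have dg' (t : R) : is_derive t 1 g' (g'' t).
  apply: is_derive_eq; rewrite /g'' /g' /GRing.scale /=; ring.
have dg'' (t : R) : is_derive t 1 g'' (g3 t).
  apply: is_derive_eq; rewrite /g3 /g'' /g' /g /GRing.scale /=; ring.
have [x x01 e] := taylor2 (fun t _ => dg t) (fun t _ => dg' t).
have x01' : 0 < x < 1 by rewrite !(itvP x01).
have gq : expR (- q0) = g 0 by rewrite /g /q; congr (expR (- _)); ring.
have -> : expR (- q 1) = g 1 by [].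
rewrite e gq (_ : _ - _ = (g'' x - g'' 0) / 2); last first.
  by rewrite /g' /g'' -!/(g _); field.
(* By [CS] the squared slope is at most 2 r q, so |g''| <= r (2 q + 1) exp(- q) <= 3 r. *)
have g''_le (t : R) : 0 <= t <= 1 -> `|g'' t| <= 3 * r.
  move=> t01; rewrite /g'' normrM (gtr0_norm (expR_gt0 _)).
  have qt := q0' t t01; have rq := mulr_ge0 r0 qt.
  have h : `|(p + r * t) ^+ 2 - r| <= r * (2 * q t + 1).
    rewrite ler_norml; have := CS t t01; have := sqr_ge0 (p + r * t).
    by move=> h1 h2; apply/andP; split; lra.
  apply: le_trans (ler_wpM2r (expR_ge0 _) h) _.
  rewrite -mulrA [leRHS]mulrC; apply: ler_wpM2l => //.
  have h0 : expR (- q t) <= 1 by rewrite expR_le1 oppr_le0.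
  have h1 := mul_expRN_le1 (q t); rewrite mulrDl -mulrA mul1r; lra.
(* Here |z| <= rho (1 + 2 q), and (1 + 2 q) (3 + 2 q) = 3 + 8 q + 4 q^2 is damped by exp(- q) to at
   most 3 + 8 + 16 = 27. *)
have g3_le (t : R) : 0 <= t <= 1 -> `|g3 t| <= 27 * (r * rho).
  move=> t01; rewrite /g3 normrM (gtr0_norm (expR_gt0 _)).
  set z := p + r * t; have Cz : z ^+ 2 <= 2 * r * q t by exact: CS.
  have qt := q0' t t01; have rq := mulr_ge0 r0 qt.
  have z1 : `|z| <= rho * (1 + 2 * q t).
    rewrite -ler_sqr ?nnegrE ?mulr_ge0 ?addr_ge0 ?mulr_ge0 //.
    rewrite real_normK ?num_real // exprMn -rE; apply: le_trans Cz _.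
    rewrite (_ : 2 * r * q t = r * (2 * q t)); last by ring.
    by apply: ler_wpM2l => //; have := sqr_ge0 (q t); lra.
  have h : `|3 * z * r - z ^+ 3| <= r * rho * (3 + 8 * q t + 4 * q t ^+ 2).
    rewrite (_ : _ - _ = z * (3 * r - z ^+ 2)); last ring.
    rewrite normrM.
    have h' : `|3 * r - z ^+ 2| <= r * (3 + 2 * q t).
      by rewrite ler_norml; have := sqr_ge0 z => ?; apply/andP; split; lra.
    apply: le_trans (ler_pM _ _ z1 h') _ => //.
    by rewrite le_eqVlt; apply/orP; left; apply/eqP; ring.
  apply: le_trans (ler_wpM2r (expR_ge0 _) h) _.
  rewrite -(mulrA (r * rho)) (mulrC 27); apply: ler_wpM2l; first by rewrite mulr_ge0.
  have h1 := mul_expRN_le1 (q t); have h2 := mul_sqr_expRN_le4 qt.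
  have h0 : expR (- q t) <= 1 by rewrite expR_le1 oppr_le0.
  by rewrite !mulrDl -!mulrA; lra.
rewrite normrM (ger0_norm (_ : 0 <= 2^-1)) // ler_pdivrMr //.
(* For rho >= 1 the two values of g'' are compared directly, at a distance of at most 6 r; otherwise
   the mean value theorem gives 27 r rho. The constant 20 exceeds half of either number. *)
rewrite minEle; case: ifP => _.
  rewrite mulr1; apply: le_trans (ler_normB _ _) _.
  have h1 : `|g'' x| <= 3 * r by apply: g''_le; rewrite !ltW // (itvP x01).
  have h2 : `|g'' 0| <= 3 * r by apply: g''_le; rewrite lexx ler01.
  by lra.
have [c c0x ->] := MVT_is_derive (proj1 (andP x01')) (fun t _ => dg'' t).
have x0 : 0 <= x by rewrite ltW // (itvP x01).
have x1 : x <= 1 by rewrite ltW // (itvP x01).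
have cx : c <= x by rewrite ltW // (itvP c0x).
rewrite subr0 normrM (ger0_norm x0).
have h : `|g3 c| <= 27 * (r * rho).
  by apply: g3_le; rewrite (le_trans cx x1) andbT ltW // (itvP c0x).
have rr : 0 <= r * rho by rewrite mulr_ge0.
apply: le_trans (ler_piMr (normr_ge0 _) x1) _; lra.
Qed.

End taylor.

(** * The heat kernel acting on a Gaussian function *)

(** Lagrange's identity: the double sum of b_i b_j (x_i y_j - x_j y_i)^2 is twice the difference of
    the two sides. *)
Lemma weighted_cauchy_schwarz (R : realFieldType) (I : finType)
    (b x y : I -> R) : (forall i, 0 <= b i) ->
  (\sum_i b i * x i * y i) ^+ 2 <=
  (\sum_i b i * x i ^+ 2) * (\sum_i b i * y i ^+ 2).
Proof.
move=> b0; rewrite -subr_ge0.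
have : 0 <= \sum_i \sum_j b i * b j * (x i * y j - x j * y i) ^+ 2.
  apply: sumr_ge0 => i _; apply: sumr_ge0 => j _.
  by rewrite mulr_ge0 ?sqr_ge0 ?mulr_ge0.
have -> : \sum_i \sum_j b i * b j * (x i * y j - x j * y i) ^+ 2 =
  \sum_i \sum_j ((b i * x i ^+ 2) * (b j * y j ^+ 2)) +
  \sum_i \sum_j ((b i * y i ^+ 2) * (b j * x j ^+ 2)) -
  2 * \sum_i \sum_j ((b i * x i * y i) * (b j * x j * y j)).
  rewrite mulr_sumr -big_split /= -sumrB; apply: eq_bigr => i _.
  rewrite mulr_sumr -big_split /= -sumrB; apply: eq_bigr => j _; ring.
rewrite -!big_distrlr /= -expr2; set a := \sum_i _; set c := \sum_i _.
by move=> h; lra.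
Qed.

Lemma is_derive_bigsum (R : realType) n (F : 'I_n -> R -> R)
    (F' : 'I_n -> R) (x : R) : (forall i, is_derive x 1 (F i) (F' i)) ->
  is_derive x 1 (fun u => \sum_i F i u) (\sum_i F' i).
Proof.
move=> dF; have -> : (fun u => \sum_i F i u) = \sum_i F i.
  by apply/funext => u; rewrite fct_sumE.
exact: is_derive_sum.
Qed.

Section heat.
Context {R : realType} {d : nat} (s : R) (mu : 'I_d -> R).
Hypotheses (s0 : 0 <= s) (mu0 : forall j, 0 <= mu j).
Implicit Types (t h : R) (x y : 'I_d -> R).

(* [heat t x] is E exp(- s |x + G|^2 / 2) for G centered normal with covariance
   [t * diag mu]; it solves v_t = 1/2 \sum_j mu_j v_(x_j x_j). *)
Definition heat_coef t j : R := s / (1 + t * s * mu j).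

(** The logarithms put the normalizing factor prod_j (1 + t s mu_j)^(-1/2) into the exponent, so
    that [heat] is a single exponential to which [taylor_expRN] applies. *)
Definition heat_exponent t x : R :=
  \sum_j (ln (1 + t * s * mu j) + heat_coef t j * x j ^+ 2) / 2.

Definition heat t x : R := expR (- heat_exponent t x).

(** The part of the exponent that depends on [x]. For t >= 0 the logarithms are nonnegative, so it
    bounds the exponent from below; the error terms are expressed through it. *)
Definition heat_quad t x : R := (\sum_j heat_coef t j * x j ^+ 2) / 2.

Let den1 t j : 0 <= t -> 1 <= 1 + t * s * mu j.
Proof. by move=> t0; rewrite lerDl !mulr_ge0. Qed.

Let den0 t j : 0 <= t -> 0 < 1 + t * s * mu j.
Proof. by move=> t0; rewrite (lt_le_trans ltr01) ?den1. Qed.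

Lemma heat_coef_ge0 t j : 0 <= t -> 0 <= heat_coef t j.
Proof. by move=> t0; rewrite divr_ge0 // ltW ?den0. Qed.

Lemma heat_coef_le t j : 0 <= t -> heat_coef t j <= s.
Proof. by move=> t0; rewrite ler_pdivrMr ?den0 // ler_peMr ?den1. Qed.

Lemma heat_quad_ge0 t x : 0 <= t -> 0 <= heat_quad t x.
Proof.
move=> t0; rewrite divr_ge0 // sumr_ge0 // => j _.
by rewrite mulr_ge0 ?sqr_ge0 ?heat_coef_ge0.
Qed.

Lemma heat_exponentE t x :
  heat_exponent t x = \sum_j ln (1 + t * s * mu j) / 2 + heat_quad t x.
Proof.
rewrite /heat_quad mulr_suml -big_split /=; apply: eq_bigr => j _.
by rewrite mulrDl.
Qed.

Lemma heat_quad_le t x : 0 <= t -> heat_quad t x <= heat_exponent t x.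
Proof.
move=> t0; rewrite heat_exponentE lerDr sumr_ge0 // => j _.
by rewrite divr_ge0 // ln_ge0 // den1.
Qed.

Lemma heat_le t x : 0 <= t -> heat t x <= expR (- heat_quad t x).
Proof. by move=> t0; rewrite ler_expR lerN2 heat_quad_le. Qed.

Lemma heat_ge0 t x : 0 <= heat t x.
Proof. exact: expR_ge0. Qed.

Lemma heat_le1 t x : 0 <= t -> heat t x <= 1.
Proof.
move=> t0; apply: le_trans (heat_le x t0) _.
by rewrite expR_le1 oppr_le0 heat_quad_ge0.
Qed.

(** From q exp(- q) <= 1 and q^2 exp(- q) <= 4: the Gaussian factor damps quadratic polynomials in
    q. This makes the errors uniform in [x]. *)
Lemma heat_mul_quad_le t x (c0 c1 c2 : R) :
  0 <= t -> 0 <= c0 -> 0 <= c1 -> 0 <= c2 ->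
  (c0 + c1 * heat_quad t x + c2 * heat_quad t x ^+ 2) * heat t x
    <= c0 + c1 + 4 * c2.
Proof.
move=> t0 c00 c10 c20; have q0 := heat_quad_ge0 x t0.
apply: le_trans (ler_wpM2l _ (heat_le x t0)) _.
  apply: addr_ge0; last by rewrite mulr_ge0 ?sqr_ge0.
  by apply: addr_ge0 => //; apply: mulr_ge0.
set q := heat_quad t x in q0 *.
have e1 : expR (- q) <= 1 by rewrite expR_le1 oppr_le0.
have e2 := mul_expRN_le1 q; have e3 := mul_sqr_expRN_le4 q0.
move: q (expR (- q)) q0 e1 e2 e3 => q e q0 e1 e2 e3.
rewrite 2!mulrDl -(mulrA c1) -(mulrA c2); apply: lerD; first apply: lerD.
- by rewrite ler_piMr.
- by rewrite ler_piMr.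
- by rewrite (mulrC 4) ler_wpM2l.
Qed.

Let M : R := s * \sum_j mu j.

Let coefM_le t j : 0 <= t -> mu j * heat_coef t j <= M.
Proof.
move=> t0; rewrite /M mulrC; apply: ler_pM; rewrite ?heat_coef_ge0 ?heat_coef_le //.
by rewrite (bigD1 j) //= lerDl sumr_ge0.
Qed.

Let M0 : 0 <= M. Proof. by rewrite mulr_ge0 ?sumr_ge0. Qed.

Let sum_coefM_le t : 0 <= t -> \sum_j mu j * heat_coef t j <= M.
Proof.
move=> t0; rewrite /M mulr_sumr; apply: ler_sum => j _.
by rewrite mulrC ler_wpM2r ?heat_coef_le.
Qed.

(** Taylor expansion along u -> t + h u. The first order term is h v_t, written through the heat
    equation as h/2 sum_j mu_j v_(x_j x_j); in this form it can be matched with the second order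
    term of a random increment. *)
Lemma heat_time_step t h x : 0 <= t -> 0 <= h ->
  `|heat (t + h) x - heat t x *
     (1 + h / 2 * \sum_j (mu j * heat_coef t j ^+ 2 * x j ^+ 2
                          - mu j * heat_coef t j))|
  <= 8 * (s * \sum_j mu j) ^+ 2 * h ^+ 2.
Proof.
move=> t0 h0; rewrite -/M.
pose b u j := heat_coef (t + h * u) j.
pose f u := heat_exponent (t + h * u) x.
pose f' u := \sum_j h / 2 * (mu j * b u j - mu j * b u j ^+ 2 * x j ^+ 2).
pose f'' u := \sum_j h ^+ 2 / 2 *
  (2 * mu j ^+ 2 * b u j ^+ 3 * x j ^+ 2 - mu j ^+ 2 * b u j ^+ 2).
have tu0 (u : R) : u \in `[0, 1] -> 0 <= t + h * u.
  by move=> u01; rewrite addr_ge0 ?mulr_ge0 // (itvP u01).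
(* In time the coefficient solves the Riccati equation b' = - mu_j b^2; the factor [h] comes from
   the parametrization. *)
have db (u : R) j : u \in `[0, 1] ->
    is_derive u 1 (b ^~ j) (- (h * mu j * b u j ^+ 2)).
  move=> u01; have := den0 j (tu0 _ u01); set D := 1 + _ => D0.
  have Dn : D != 0 by rewrite gt_eqF.
  have dD : is_derive u 1 (fun u => 1 + (t + h * u) * s * mu j) (h * s * mu j).
    by apply: is_derive_eq; rewrite /GRing.scale /=; ring.
  have dV := is_deriveV (f := fun u => 1 + (t + h * u) * s * mu j) Dn dD.
  rewrite /b /heat_coef; apply: is_derive_eq; rewrite /GRing.scale /= -/D.
  by field.
have df (u : R) : u \in `[0, 1] -> is_derive u 1 f (f' u).
  move=> u01; rewrite /f /heat_exponent; apply: is_derive_bigsum => j.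
  have := den0 j (tu0 _ u01) => D0.
  have dD : is_derive u 1 (fun u => 1 + (t + h * u) * s * mu j) (h * s * mu j).
    by apply: is_derive_eq; rewrite /GRing.scale /=; ring.
  have dln := is_derive1_ln D0.
  have dlnD := is_derive1_comp (g := fun u => 1 + (t + h * u) * s * mu j) dln dD.
  have dbj := db u j u01.
  have -> : (fun u => (ln (1 + (t + h * u) * s * mu j)
      + heat_coef (t + h * u) j * x j ^+ 2) / 2) =
    2^-1 \*: ((@ln R \o (fun u => 1 + (t + h * u) * s * mu j))
              + (x j ^+ 2) \*: (b ^~ j)).
    apply/funext => v; rewrite /GRing.scale /= mulrC.
    by congr (_ * (_ + _)); rewrite mulrC.
  apply: is_derive_eq; rewrite /GRing.scale /= /b /heat_coef; field.
  by rewrite gt_eqF.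
have df' (u : R) : u \in `[0, 1] -> is_derive u 1 f' (f'' u).
  move=> u01; apply: is_derive_bigsum => j; have dbj := db u j u01.
  by apply: is_derive_eq; rewrite /GRing.scale /=; field.
have f'_le (u : R) : u \in `[0, 1] ->
    `|f' u| <= h * M * (1 / 2 + heat_quad (t + h * u) x).
  move=> u01; rewrite /f' -mulr_sumr normrM ger0_norm ?divr_ge0 //.
  have T0 := tu0 u u01; set T := t + h * u in T0 *.
  have q0 := heat_quad_ge0 x T0.
  have h1 : `|\sum_j (mu j * b u j - mu j * b u j ^+ 2 * x j ^+ 2)|
      <= \sum_j (mu j * b u j + M * (b u j * x j ^+ 2)).
    apply: le_trans (ler_norm_sum _ _ _) _; apply: ler_sum => j _.
    have bj0 : 0 <= b u j by exact: heat_coef_ge0.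
    apply: le_trans (ler_normB _ _) _.
    have e1 : 0 <= mu j * b u j by rewrite mulr_ge0.
    have e2 : 0 <= mu j * b u j ^+ 2 * x j ^+ 2.
      by apply: mulr_ge0; [apply: mulr_ge0|]; rewrite ?sqr_ge0.
    rewrite (ger0_norm e1) (ger0_norm e2) lerD2l.
    rewrite [leLHS](_ : _ = mu j * b u j * (b u j * x j ^+ 2)); last by ring.
    by apply: ler_wpM2r; [rewrite mulr_ge0 ?sqr_ge0|exact: coefM_le].
  have h2 : \sum_j (mu j * b u j + M * (b u j * x j ^+ 2)) <=
      M + M * (2 * heat_quad T x).
    rewrite big_split /= lerD ?sum_coefM_le // -mulr_sumr /heat_quad.
    by rewrite (mulrC 2) divfK.
  rewrite (_ : h * M * _ = h / 2 * (M + M * (2 * heat_quad T x))); last by field.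
  apply: ler_wpM2l; first by rewrite divr_ge0.
  exact: le_trans h1 h2.
have f''_le (u : R) : u \in `[0, 1] ->
    `|f'' u| <= h ^+ 2 * M ^+ 2 * (1 / 2 + 2 * heat_quad (t + h * u) x).
  move=> u01; rewrite /f'' -mulr_sumr normrM ger0_norm ?divr_ge0 ?sqr_ge0 //.
  have T0 := tu0 u u01; set T := t + h * u in T0 *.
  have q0 := heat_quad_ge0 x T0.
  have h1 : `|\sum_j (2 * mu j ^+ 2 * b u j ^+ 3 * x j ^+ 2
                       - mu j ^+ 2 * b u j ^+ 2)|
      <= \sum_j (2 * M ^+ 2 * (b u j * x j ^+ 2) + M * (mu j * b u j)).
    apply: le_trans (ler_norm_sum _ _ _) _; apply: ler_sum => j _.
    have bj0 : 0 <= b u j by exact: heat_coef_ge0.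
    have bM : mu j * b u j <= M by exact: coefM_le.
    have bM0 : 0 <= mu j * b u j by rewrite mulr_ge0.
    apply: le_trans (ler_normB _ _) _.
    have e1 : 0 <= 2 * mu j ^+ 2 * b u j ^+ 3 * x j ^+ 2.
      apply: mulr_ge0 (sqr_ge0 _); apply: mulr_ge0 (exprn_ge0 3 bj0).
      exact: mulr_ge0 (sqr_ge0 _).
    have e2 : 0 <= mu j ^+ 2 * b u j ^+ 2 by rewrite mulr_ge0 ?sqr_ge0.
    rewrite (ger0_norm e1) (ger0_norm e2); apply: lerD.
      rewrite [leLHS](_ : _ = 2 * (mu j * b u j) ^+ 2 * (b u j * x j ^+ 2)).
        apply: ler_wpM2r; first by rewrite mulr_ge0 ?sqr_ge0.
        by apply: ler_wpM2l => //; rewrite ler_sqr.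
      by ring.
    rewrite [leLHS](_ : _ = (mu j * b u j) * (mu j * b u j)); last by ring.
    exact: ler_wpM2r.
  have h2 : \sum_j (2 * M ^+ 2 * (b u j * x j ^+ 2) + M * (mu j * b u j)) <=
      2 * M ^+ 2 * (2 * heat_quad T x) + M * M.
    have qE : \sum_j b u j * x j ^+ 2 = 2 * heat_quad T x.
      by rewrite /heat_quad (mulrC 2) divfK.
    rewrite big_split /= -!mulr_sumr qE lerD2l.
    by apply: ler_wpM2l => //; exact: sum_coefM_le.
  rewrite (_ : h ^+ 2 * M ^+ 2 * _ =
    h ^+ 2 / 2 * (2 * M ^+ 2 * (2 * heat_quad T x) + M * M)); last by field.
  apply: ler_wpM2l; first by rewrite divr_ge0 ?sqr_ge0.
  exact: le_trans h1 h2.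
have bnd (u : R) : u \in `[0, 1] ->
    `|f' u ^+ 2 - f'' u| * expR (- f u) <= 8 * M ^+ 2 * h ^+ 2.
  move=> u01; have T0 := tu0 u u01.
  have q0 := heat_quad_ge0 x T0.
  (* The polynomial is (1/2 + q)^2 + (1/2 + 2 q), from the bounds on f'^2 and f''. Damped, it is at
     most 3/4 + 3 + 4 <= 8, which is the constant of the statement. *)
  have hq : (3 / 4 + 3 * heat_quad (t + h * u) x
      + 1 * heat_quad (t + h * u) x ^+ 2) * expR (- f u) <= 8.
    by apply: le_trans (heat_mul_quad_le x T0 _ _ _) _; lra.
  set q := heat_quad _ _ in q0 hq *; set e := expR _ in hq *.
  have e0 : 0 <= e by rewrite expR_ge0.
  have h1 : f' u ^+ 2 <= (h * M * (1 / 2 + q)) ^+ 2.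
    rewrite -[f' u ^+ 2]real_normK ?num_real // ler_sqr ?nnegrE ?f'_le //.
    by apply: mulr_ge0; [apply: mulr_ge0|lra].
  have h2 : `|f' u ^+ 2 - f'' u| <=
      h ^+ 2 * M ^+ 2 * (3 / 4 + 3 * q + 1 * q ^+ 2).
    apply: le_trans (ler_normB _ _) _; rewrite (ger0_norm (sqr_ge0 _)).
    apply: le_trans (lerD h1 (f''_le u u01)) _; rewrite -/q.
    by rewrite le_eqVlt; apply/orP; left; apply/eqP; field.
  apply: le_trans (ler_wpM2r e0 h2) _; rewrite -(mulrA (h ^+ 2 * M ^+ 2)).
  rewrite (_ : 8 * _ * _ = h ^+ 2 * M ^+ 2 * 8); last by ring.
  by apply: ler_wpM2l; [rewrite mulr_ge0 ?sqr_ge0|lra].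
have := taylor_expRN df df' bnd.
rewrite /f mulr1 mulr0 addr0 -/(heat _ _) -/(heat _ _).
rewrite (_ : 1 - f' 0 = 1 + h / 2 *
  \sum_j (mu j * heat_coef t j ^+ 2 * x j ^+ 2 - mu j * heat_coef t j)) //.
rewrite /f' /b mulr0 addr0 -mulr_sumr -mulrN -sumrN; congr (_ + _ * _).
by apply: eq_bigr => j _; rewrite opprB.
Qed.

End heat.

(** * Integration of real functions against a probability *)

Section real_integrable.
Context {R : realType} {dT : measure_display} {T : measurableType dT}
  (P : probability T R).
Implicit Types f g : T -> R.

Let integrable f := P.-integrable setT (EFin \o f).

Lemma integrable_addr f g : integrable f -> integrable g ->
  integrable (fun w => f w + g w).
Proof.
move=> fi gi; apply: eq_integrable (integrableD _ fi gi) => //.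
Qed.

Lemma integrable_scaler k f : integrable f -> integrable (fun w => k * f w).
Proof.
move=> fi; apply: eq_integrable (integrableZl _ k fi) => //.
Qed.

Lemma integrable_subr f g : integrable f -> integrable g ->
  integrable (fun w => f w - g w).
Proof.
move=> fi gi; apply: eq_integrable (integrableB _ fi gi) => //.
Qed.

Lemma integrable_sumr (I : finType) (F : I -> T -> R) :
  (forall i, integrable (F i)) -> integrable (fun w => \sum_i F i w).
Proof.
move=> Fi; apply: eq_integrable
  (integrable_sum _ _ (fun i (_ : xpredT i) => Fi i)) => //.
by move=> w _; rewrite /= sumEFin.
Qed.

Lemma integrable_cstr k : integrable (fun=> k).
Proof. exact: finite_measure_integrable_cst. Qed.

Lemma integrable_boundr f (M : R) : measurable_fun setT f ->
  (forall w, `|f w| <= M) -> integrable f.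
Proof.
move=> mf fM; apply: measurable_bounded_integrable => //.
  exact: fin_num_fun_lty.
exists M; split; first exact: num_real.
by move=> N MN w _ /=; apply: le_trans (fM w) (ltW MN).
Qed.

Lemma integrable_ler f g : measurable_fun setT f ->
  (forall w, `|f w| <= g w) -> integrable g -> integrable f.
Proof.
move=> mf fg; apply: le_integrable => //; first exact/measurable_EFinP.
by move=> w _; rewrite /= lee_fin (le_trans (fg w)) // ler_norm.
Qed.

Lemma Rintegral_sumr (I : finType) (F : I -> T -> R) :
  (forall i, integrable (F i)) ->
  \int[P]_w (\sum_i F i w) = \sum_i \int[P]_w F i w.
Proof.
move=> Fi; rewrite /Rintegral; under eq_integral do rewrite -sumEFin.
rewrite integral_sum //.
by apply/esym/sum_fine => i _; exact: integrable_fin_num (Fi i).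
Qed.

Lemma Rintegral_cstr k : \int[P]_w k = k.
Proof.
transitivity (k * fine (P setT)); first exact: Rintegral_cst.
by rewrite (probability_setT P) mulr1.
Qed.

Lemma le_dist_Rintegral f g e : integrable f -> integrable g -> integrable e ->
  (forall w, `|f w - g w| <= e w) ->
  `|\int[P]_w f w - \int[P]_w g w| <= \int[P]_w e w.
Proof.
move=> fi gi ei fge; rewrite -RintegralB //.
apply: le_trans (le_normr_Rintegral _ _) _ => //; first exact: integrable_subr.
apply: le_Rintegral => //.
apply: integrable_ler ei => [|w]; last by rewrite normr_id.
apply: measurableT_comp => //; apply/measurable_EFinP.
exact: (measurable_int P (integrable_subr fi gi)).
Qed.

End real_integrable.

(** * One random increment against one time step *)

Section heat_step.
Context {R : realType} {d : nat} (s : R) (mu : 'I_d -> R).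
Hypotheses (s0 : 0 <= s) (mu0 : forall j, 0 <= mu j).
Implicit Types (t h : R) (x y : 'I_d -> R).

Local Notation b := (heat_coef s mu).
Local Notation v := (heat s mu).

(** Along u -> x + u y the exponent is a quadratic polynomial with slope p + r u, and Cauchy-Schwarz
    with the weights [heat_coef] is the hypothesis of [taylor_gaussian]. The weights are at most
    [s], so r may be replaced by s |y|^2 in the error. *)
Lemma heat_space_step t x y : 0 <= t ->
  `|v t (fun j => x j + y j) - v t x * (1 - \sum_j b t j * x j * y j
       + ((\sum_j b t j * x j * y j) ^+ 2 - \sum_j b t j * y j ^+ 2) / 2)|
  <= 20 * (s * \sum_j y j ^+ 2)
        * Num.min 1 (Num.sqrt (s * \sum_j y j ^+ 2)).
Proof.
move=> t0; set p := \sum_j b t j * x j * y j.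
set r := \sum_j b t j * y j ^+ 2.
have b0 j : 0 <= b t j by exact: heat_coef_ge0.
have r0 : 0 <= r by rewrite sumr_ge0 // => j _; rewrite mulr_ge0 ?sqr_ge0.
have rS : r <= s * \sum_j y j ^+ 2.
  rewrite mulr_sumr; apply: ler_sum => j _.
  by rewrite ler_wpM2r ?sqr_ge0 ?heat_coef_le.
have qE (u : R) : heat_exponent s mu t x + p * u + r * u ^+ 2 / 2 =
    heat_exponent s mu t (fun j => x j + u * y j).
  rewrite !heat_exponentE -!addrA; congr (_ + _).
  rewrite /heat_quad /p /r !mulr_suml -!big_split /=.
  by apply: eq_bigr => j _; field.
have CS (u : R) : 0 <= u <= 1 -> (p + r * u) ^+ 2 <=
    2 * r * (heat_exponent s mu t x + p * u + r * u ^+ 2 / 2).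
  move=> _; rewrite qE.
  have -> : p + r * u = \sum_j b t j * (x j + u * y j) * y j.
    by rewrite /p /r mulr_suml -big_split /=; apply: eq_bigr => j _; ring.
  apply: le_trans (weighted_cauchy_schwarz _ _ b0) _.
  rewrite -/r mulrC (mulrC 2) -mulrA; apply: ler_wpM2l => //.
  have := heat_quad_le s0 mu0 (fun j => x j + u * y j) t0; rewrite /heat_quad.
  by rewrite ler_pdivrMr // mulrC.
have q0 (u : R) : 0 <= u <= 1 ->
    0 <= heat_exponent s mu t x + p * u + r * u ^+ 2 / 2.
  move=> _; rewrite qE; apply: le_trans (heat_quad_le _ _ _ t0) => //.
  exact: heat_quad_ge0.
have := taylor_gaussian (sqrtr_ge0 r) (esym (sqr_sqrtr r0)) CS q0.
rewrite qE /heat (_ : (fun j => x j + 1 * y j) = (fun j => x j + y j)); last first.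
  by apply/funext => j; rewrite mul1r.
move=> /le_trans; apply; rewrite -!(mulrA 20); apply: ler_wpM2l => //.
have m0 : 0 <= Num.min 1 (Num.sqrt r) by rewrite le_min ler01 sqrtr_ge0.
apply: ler_pM => //.
apply: le_min2; first exact: lexx.
by rewrite ler_sqrt // (le_trans r0).
Qed.

Context {dT : measure_display} {T : measurableType dT} (P : probability T R).
Variables (Y : 'I_d -> T -> R) (C : 'I_d -> 'I_d -> R).
Hypothesis mY : forall j, measurable_fun setT (Y j).
Hypothesis iY : forall j, P.-integrable setT (EFin \o Y j).
Hypothesis iYY : forall j k, P.-integrable setT (EFin \o (fun w => Y j w * Y k w)).
Hypothesis EY : forall j, \int[P]_w Y j w = 0.
Hypothesis EYY : forall j k, \int[P]_w (Y j w * Y k w) = C j k.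

Let A w : R := \sum_j Y j w ^+ 2.

Lemma heat_measurable t x (h : R) :
  measurable_fun setT (fun w => v t (fun j => x j + h * Y j w)).
Proof.
apply: measurableT_comp => //; apply: measurableT_comp => //.
apply: measurable_sum => j; apply: measurable_funM => //.
apply: measurable_funD => //; apply: measurable_funM => //.
apply: measurable_funX; apply: measurable_funD => //.
exact: measurable_funM.
Qed.

(** Three comparisons: the space expansion, whose linear term has mean zero ([H1]); the exchange of
    the covariance [C] for diag mu ([H4]); the time step ([H2]), which then has the same main term.
    Each error carries a factor [h], so n = 1/h steps can be added up. *)
Lemma heat_one_step t x (n : nat) (eps eta : R) : 0 <= t -> (0 < n)%N ->
  0 <= eps -> 0 <= eta ->
  (forall j k, `|C j k - (j == k)%:R * mu j| <= eta) ->
  forall h L : R, h = n%:R^-1 -> L = \int[P]_w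
    (A w * \1_[set w' | Num.sqrt n%:R * eps < Num.sqrt (A w')] w) ->
  `|\int[P]_w v t (fun j => x j + Num.sqrt h * Y j w) - v (t + h) x| <=
  h * (20 * s * (Num.sqrt s * eps * (\sum_j mu j + d%:R * eta) + L)
       + 2 * eta * d%:R * s + 8 * (s * \sum_j mu j) ^+ 2 * h).
Proof.
move=> t0 n0 eps0 eta0 Ceta h L hE LE.
have nR : 0 < n%:R :> R by rewrite ltr0n.
have h0 : 0 <= h by rewrite hE invr_ge0 ltW.
have sh : Num.sqrt h ^+ 2 = h by rewrite sqr_sqrtr.
have b0 j : 0 <= b t j by exact: heat_coef_ge0.
have mA : measurable_fun setT A.
  by apply: measurable_sum => j; exact: measurable_funX.
have A0 w : 0 <= A w by rewrite sumr_ge0 // => j _; exact: sqr_ge0.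
have iA : P.-integrable setT (EFin \o A).
  by apply: integrable_sumr => j; apply: eq_integrable (iYY j j).
have EA : \int[P]_w A w = \sum_j C j j.
  rewrite /A Rintegral_sumr => [|j]; last by apply: eq_integrable (iYY j j).
  by apply: eq_bigr => j _; rewrite -EYY.
pose B := [set w | Num.sqrt n%:R * eps < Num.sqrt (A w)].
have mB : measurable B.
  rewrite -[B]setTI; apply: (measurable_fun_ltr (measurable_cst _) _ measurableT
    (Y := [set true])) => //.
  by apply: measurableT_comp mA; apply: continuous_measurable_fun; exact: sqrt_continuous.
have iAB : P.-integrable setT (EFin \o (fun w => A w * \1_B w)).
  apply: integrable_ler iA => [|w].
    by apply: measurable_funM => //; exact: measurable_indic.
  rewrite normrM (ger0_norm (A0 w)) indicE.
  by case: (_ \in _); rewrite ?normr1 ?normr0 ?mulr1 ?mulr0.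
pose p w := \sum_j b t j * x j * (Num.sqrt h * Y j w).
pose r w := \sum_j b t j * (Num.sqrt h * Y j w) ^+ 2.
pose g w := v t x * (1 - p w + (p w ^+ 2 - r w) / 2).
pose e w := 20 * s * h * (Num.sqrt s * eps * A w + A w * \1_B w).
have rE w : r w = \sum_j h * b t j * (Y j w * Y j w).
  by apply: eq_bigr => j _; rewrite exprMn sh; ring.
have pE w : p w = \sum_j b t j * x j * Num.sqrt h * Y j w.
  by apply: eq_bigr => j _; rewrite mulrA.
have p2E w : p w ^+ 2 =
    \sum_j \sum_k h * (b t j * x j * (b t k * x k)) * (Y j w * Y k w).
  rewrite expr2 big_distrlr /=; apply: eq_bigr => j _; apply: eq_bigr => k _.
  by rewrite -[in RHS]sh; ring.
have ip : P.-integrable setT (EFin \o p).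
  by under [p]funext do rewrite pE; apply: integrable_sumr => j; exact: integrable_scaler.
have ir : P.-integrable setT (EFin \o r).
  by under [r]funext do rewrite rE; apply: integrable_sumr => j; exact: integrable_scaler.
have ip2 : P.-integrable setT (EFin \o (fun w => p w ^+ 2)).
  under [fun w => p w ^+ 2]funext do rewrite p2E.
  by do 2 (apply: integrable_sumr => ?); exact: integrable_scaler.
pose Q := \sum_j \sum_k b t j * x j * (b t k * x k) * C j k.
pose D := \sum_j b t j * C j j.
have Er : \int[P]_w r w = h * D.
  under eq_Rintegral do rewrite rE.
  rewrite Rintegral_sumr => [|j]; last exact: integrable_scaler.
  rewrite mulr_sumr; apply: eq_bigr => j _.
  by rewrite RintegralZl // EYY mulrA.
have Ep2 : \int[P]_w (p w ^+ 2) = h * Q.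
  under eq_Rintegral do rewrite p2E.
  rewrite Rintegral_sumr => [|j]; last first.
    by apply: integrable_sumr => k; exact: integrable_scaler.
  rewrite mulr_sumr; apply: eq_bigr => j _.
  rewrite Rintegral_sumr => [|k]; last exact: integrable_scaler.
  rewrite mulr_sumr; apply: eq_bigr => k _.
  by rewrite RintegralZl // EYY !mulrA.
have Ep : \int[P]_w p w = 0.
  under eq_Rintegral do rewrite pE.
  rewrite Rintegral_sumr => [|j]; last exact: integrable_scaler.
  by apply: big1 => j _; rewrite RintegralZl // EY mulr0.
have i1p : P.-integrable setT (EFin \o (fun w => 1 - p w)).
  by apply: integrable_subr => //; exact: integrable_cstr.
have ip2r : P.-integrable setT (EFin \o (fun w => p w ^+ 2 - r w)).
  exact: integrable_subr.
have ip2r2 : P.-integrable setT (EFin \o (fun w => (p w ^+ 2 - r w) / 2)).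
  by under [fun w => _ / 2]funext do rewrite mulrC; exact: integrable_scaler.
have ipp : P.-integrable setT (EFin \o (fun w => 1 - p w + (p w ^+ 2 - r w) / 2)).
  exact: integrable_addr.
have ig : P.-integrable setT (EFin \o g) by exact: integrable_scaler.
have Eg : \int[P]_w g w = v t x * (1 + h / 2 * (Q - D)).
  rewrite RintegralZl // RintegralD // RintegralB //; last exact: integrable_cstr.
  rewrite RintegralZr // RintegralB // Ep Ep2 Er Rintegral_cstr.
  by congr (_ * _); ring.
have ie : P.-integrable setT (EFin \o e).
  by apply: integrable_scaler; apply: integrable_addr => //; exact: integrable_scaler.
have Ee : \int[P]_w e w = 20 * s * h * (Num.sqrt s * eps * (\sum_j C j j) + L).
  rewrite RintegralZl //; last first.
    by apply: integrable_addr => //; exact: integrable_scaler.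
  rewrite RintegralD //; last exact: integrable_scaler.
  by rewrite RintegralZl // EA LE.
have iv : P.-integrable setT
    (EFin \o (fun w => v t (fun j => x j + Num.sqrt h * Y j w))).
  apply: (@integrable_boundr _ _ _ P _ 1); first exact: heat_measurable.
  by move=> w; rewrite ger0_norm ?heat_ge0 // heat_le1.
have vge w : `|v t (fun j => x j + Num.sqrt h * Y j w) - g w| <= e w.
  pose y j := Num.sqrt h * Y j w.
  have yE : \sum_j y j ^+ 2 = h * A w.
    by rewrite mulr_sumr; apply: eq_bigr => j _; rewrite exprMn sh.
  apply: le_trans (heat_space_step x y t0) _; rewrite yE /e.
  have sA : 0 <= s * (h * A w) by rewrite !mulr_ge0.
  rewrite [leRHS](_ : _ =
    20 * (s * (h * A w)) * (Num.sqrt s * eps + \1_B w)); last by ring.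
  apply: ler_wpM2l; first by rewrite mulr_ge0.
  (* On [B] the minimum is at most 1. Off [B], sqrt A <= sqrt n * eps and h = 1/n give sqrt (s h A)
     <= sqrt s * eps. *)
  rewrite indicE; have [wB|wB] := boolP (w \in B).
    by rewrite ge_min lerDr mulr_ge0 ?sqrtr_ge0.
  rewrite ge_min addr0; apply/orP; right.
  have {}wB : Num.sqrt (A w) <= Num.sqrt n%:R * eps.
    by rewrite leNgt; apply: contraNN wB => ?; rewrite inE.
  rewrite sqrtrM // ler_wpM2l ?sqrtr_ge0 // sqrtrM //.
  rewrite hE (sqrtrV (ltW nR)) mulrC ler_pdivrMr ?sqrtr_gt0 //.
  by rewrite (mulrC eps).
have := le_dist_Rintegral iv ig ie vge; rewrite Eg Ee => H1.
have H2 := heat_time_step s0 mu0 x t0 h0.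
set S0 := \sum_j (_ - _) in H2.
have SC : \sum_j C j j <= \sum_j mu j + d%:R * eta.
  have -> : d%:R * eta = \sum_(j < d) eta by rewrite sumr_const card_ord mulr_natl.
  rewrite -big_split /=; apply: ler_sum => j _.
  by have := Ceta j j; rewrite eqxx mul1r ler_norml => /andP[_]; lra.
have q0 := heat_quad_ge0 s0 mu0 x t0.
have sumb : \sum_j b t j <= d%:R * s.
  have -> : d%:R * s = \sum_(j < d) s by rewrite sumr_const card_ord mulr_natl.
  by apply: ler_sum => j _; exact: heat_coef_le.
have sumb0 : 0 <= \sum_j b t j by exact: sumr_ge0.
(* The difference is the quadratic form of C - diag mu at the vector (b_j x_j), minus a weighted sum
   of diagonal entries. Entries bounded by [eta] bound the form by eta (sum_j b_j |x_j|)^2, and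
   Cauchy-Schwarz bounds this square by (sum_j b_j) (sum_j b_j x_j^2) <= 2 d s q. *)
have H3 : `|Q - D - S0| <= eta * (d%:R * s) * (1 + 2 * heat_quad s mu t x).
  have -> : Q - D - S0 =
      \sum_j \sum_k b t j * x j * (b t k * x k) * (C j k - (j == k)%:R * mu j)
      - \sum_j b t j * (C j j - mu j).
    have -> : \sum_j \sum_k b t j * x j * (b t k * x k) *
        (C j k - (j == k)%:R * mu j) = Q - \sum_j mu j * b t j ^+ 2 * x j ^+ 2.
      rewrite -sumrB; apply: eq_bigr => j _.
      under eq_bigr do rewrite mulrBr.
      rewrite sumrB; congr (_ - _); rewrite (bigD1 j) //= eqxx big1 ?addr0.
        by rewrite mul1r; ring.
      by move=> k; rewrite eq_sym => /negbTE ->; rewrite mul0r mulr0.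
    under [\sum_j b t j * (_ - _)]eq_bigr do rewrite mulrBr (mulrC _ (mu _)).
    by rewrite /S0 !sumrB /D; ring.
  apply: le_trans (ler_normB _ _) _; rewrite mulrDr mulr1 addrC; apply: lerD.
    apply: le_trans (ler_norm_sum _ _ _) _.
    apply: (@le_trans _ _ (eta * \sum_j b t j)); last by apply: ler_wpM2l.
    rewrite mulr_sumr; apply: ler_sum => j _; rewrite normrM ger0_norm // mulrC.
    by apply: ler_wpM2r => //; have := Ceta j j; rewrite eqxx mul1r.
  apply: (@le_trans _ _ (eta * (\sum_j b t j * `|x j| * 1) ^+ 2)).
    rewrite expr2 big_distrlr /= mulr_sumr.
    apply: le_trans (ler_norm_sum _ _ _) _; apply: ler_sum => j _.
    rewrite mulr_sumr.
    apply: le_trans (ler_norm_sum _ _ _) _; apply: ler_sum => k _.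
    rewrite !mulr1 (normrM (_ * (_ * _))) (normrM (b t j * x j)).
    rewrite (normrM (b t j)) (normrM (b t k)) (ger0_norm (b0 j)) (ger0_norm (b0 k)).
    rewrite [leLHS]mulrC.
    by apply: ler_wpM2r => //; apply: mulr_ge0; apply: mulr_ge0; rewrite ?b0.
  rewrite -(mulrA eta); apply: ler_wpM2l => //.
  apply: le_trans (weighted_cauchy_schwarz _ _ b0) _.
  rewrite mulrC; apply: ler_pM.
  - by apply: sumr_ge0 => j _; rewrite mulr_ge0 ?sqr_ge0.
  - by apply: sumr_ge0 => j _; rewrite mulr_ge0 ?sqr_ge0.
  - by under eq_bigr do rewrite expr1n mulr1.
  - under eq_bigr do rewrite real_normK ?num_real //.
    by rewrite /heat_quad (mulrC 2) divfK.
have v0 : 0 <= v t x by exact: heat_ge0.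
have H4 : `|v t x * (1 + h / 2 * (Q - D)) - v t x * (1 + h / 2 * S0)| <=
    h * (2 * eta * d%:R * s).
  rewrite -mulrBr (_ : _ - _ = h / 2 * (Q - D - S0)); last by ring.
  rewrite normrM (ger0_norm v0) normrM ger0_norm ?divr_ge0 //.
  rewrite [leLHS](_ : _ = h * (2^-1 * (v t x * `|Q - D - S0|))); last by ring.
  apply: ler_wpM2l => //.
  have := ler_wpM2l v0 H3; set a := v t x * `|_ - _|.
  (* This gives (1 + 2 q) v <= 3, and 3/2 stays below the factor 2 of the claim. *)
  have := heat_mul_quad_le s0 mu0 x t0 (c0 := 1) (c1 := 2) (c2 := 0).
  rewrite ler01 ler0n lexx => /(_ isT isT isT).
  rewrite -/(v t x) mul0r addr0 mulr0 addr0 => HH.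
  have := ler_wpM2l (mulr_ge0 eta0 (mulr_ge0 (ler0n _ d) s0)) HH.
  set K := eta * (d%:R * s); have K0 : 0 <= K by rewrite !mulr_ge0.
  rewrite (_ : 2 * eta * d%:R * s = 2 * K); last by rewrite /K; ring.
  by lra.
have := lerD (lerD H1 H4) H2.
set I := \int[P]_w _ => H5.
rewrite (_ : I - v (t + h) x =
  (I - v t x * (1 + h / 2 * (Q - D))) +
  (v t x * (1 + h / 2 * (Q - D)) - v t x * (1 + h / 2 * S0)) -
  (v (t + h) x - v t x * (1 + h / 2 * S0))); last by ring.
apply: le_trans (ler_normB _ _) _.
apply: le_trans (lerD (ler_normD _ _) (lexx _)) _.
apply: le_trans H5 _; rewrite [in leRHS]mulrDr [in leRHS]mulrDr.
apply: lerD; last by rewrite le_eqVlt; apply/orP; left; apply/eqP; ring.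
rewrite lerD2r mulrA (mulrC h); apply: ler_wpM2l; first by rewrite !mulr_ge0.
by rewrite lerD2r; apply: ler_wpM2l => //; rewrite mulr_ge0 ?sqrtr_ge0.
Qed.

End heat_step.

(** * Independence and Fubini *)

Section independence.
Context {R : realType} {dT dU : measure_display} {T : measurableType dT}
  {U : measurableType dU} (P : probability T R).

(** Uniqueness of product measures, twice. The law of (A, B) under [P] restricted to [E] agrees on
    rectangles with a product in which the first factor is scaled by [p]; that product is in turn
    [p] times the product of the laws. Keeping [E] carries the remaining variables along. *)
Lemma product_law_on dW (W : measurableType dW) (A : {mfun T >-> W})
    (B : {mfun T >-> U}) (E : set T) (p : {nonneg R}) : measurable E ->
  (forall S V, measurable S -> measurable V ->
    P ((A @^-1` S `&` B @^-1` V) `&` E) =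
    (p%:num%:E * (P (A @^-1` S) * P (B @^-1` V)))%E) ->
  forall C, measurable C -> P ((fun w => (A w, B w)) @^-1` C `&` E) =
    (p%:num%:E * (distribution P A \x distribution P B) C)%E.
Proof.
move=> mE rect C mC.
have mAB : measurable_fun setT (fun w => (A w, B w)).
  by apply/measurable_fun_pairP; split; exact: measurable_funP.
pose AB : {mfun T >-> (W * U)%type} := HB.pack (fun w => (A w, B w))
  (isMeasurableFun.Build _ _ _ _ _ mAB).
pose m1 := mscale p (distribution P A).
pose nu := pushforward (mrestr P mE) AB.
have e1 : (m1 \x distribution P B)%E C = nu C.
  apply: product_measure_unique => // S V mS mV.
  by rewrite /nu /pushforward /= /mrestr /m1 /mscale /= -muleA -rect.
rewrite -[LHS]/(nu C) -e1.
rewrite -[RHS]/(mscale p (distribution P A \x distribution P B)%E C).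
apply: product_measure_unique => // S V mS mV.
rewrite -[LHS]/(p%:num%:E *
  (distribution P A \x distribution P B) (S `*` V))%E.
by rewrite product_measure1E // muleA.
Qed.

(* Tested on rectangles only; [A] is meant to be a function of the variables
   [X i] with [i] outside [J]. *)
Definition independent_of (I : finType) (X : I -> {RV P >-> U}) dW
    (W : measurableType dW) (A : {mfun T >-> W}) (J : {set I}) :=
  forall (S : set W) (V : I -> set U), measurable S ->
    (forall i, measurable (V i)) ->
  P (A @^-1` S `&` \bigcap_(i in [set` J]) (X i @^-1` V i)) =
  (P (A @^-1` S) * \prod_(i in J) P (X i @^-1` V i))%E.

Context {I : finType} (X : I -> {RV P >-> U}).

Lemma independent_of_cst dW (W : measurableType dW) (A : {mfun T >-> W}) c J :
  independent X -> (forall w, A w = c) -> independent_of X A J.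
Proof.
move=> indX Ac S V mS mV; have [cS|cS] := pselect (S c).
  have -> : A @^-1` S = setT by apply/seteqP; split=> w //= _; rewrite Ac.
  by rewrite setTI indX // probability_setT mul1e.
have -> : A @^-1` S = set0 by apply/seteqP; split=> w //=; rewrite Ac.
by rewrite set0I measure0 mul0e.
Qed.

Let mcap (J : {set I}) (V : I -> set U) : (forall i, measurable (V i)) ->
  measurable (\bigcap_(i in [set` J]) (X i @^-1` V i)).
Proof.
by move=> mV; apply: fin_bigcap_measurable => // i _; exact: measurable_funPTI.
Qed.

Let prodP_fin (J : {set I}) (V : I -> set U) : (forall i, measurable (V i)) ->
  exists p : {nonneg R}, (\prod_(i in J) P (X i @^-1` V i))%E = p%:num%:E.
Proof.
move=> mV; pose q := \prod_(i in J) fine (P (X i @^-1` V i)).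
have q0 : 0 <= q by apply: prodr_ge0 => i _; apply: fine_ge0.
exists (NngNum q0) => /=; rewrite /q -prodEFin; apply: eq_bigr => i _.
by rewrite fineK // fin_num_measure //; exact: measurable_funPTI.
Qed.

(** [product_law_on] with [E] the event of the variables in [J] other than [i]: the pair (A, X i)
    has a product law and is independent of those variables. *)
Lemma independent_of_law dW (W : measurableType dW) (A : {mfun T >-> W}) J i :
  independent_of X A J -> i \in J ->
  forall C (V : I -> set U), measurable C -> (forall j, measurable (V j)) ->
  P ((fun w => (A w, X i w)) @^-1` C `&`
     \bigcap_(j in [set` J :\ i]) (X j @^-1` V j)) =
  ((\prod_(j in J :\ i) P (X j @^-1` V j)) *
     (distribution P A \x distribution P (X i)) C)%E.
Proof.
move=> ind iJ C V mC mV; have [p pE] := prodP_fin (J :\ i) mV; rewrite pE.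
apply: product_law_on => //; first exact: mcap.
move=> S V' mS mV'; rewrite -pE.
(* Inserting V' at [i] turns the event into one covered by the rectangle hypothesis for the whole of
   [J]. *)
pose V2 j := if j == i then V' else V j.
have mV2 j : measurable (V2 j) by rewrite /V2; case: eqP.
have := ind S V2 mS mV2; rewrite (bigD1 i) //=.
have -> : (\prod_(j in J | j != i) P (X j @^-1` V2 j))%E =
    (\prod_(j in J :\ i) P (X j @^-1` V j))%E.
  apply: eq_big => [j|j /andP[_ /negbTE ji]]; first by rewrite !inE andbC.
  by rewrite /V2 ji.
rewrite {2}/V2 eqxx muleA muleC => <-; congr (P _).
rewrite -setIA; congr (_ `&` _); apply/seteqP; split => w /=.
  move=> [wi wJ] j /= jJ; rewrite /V2; case: eqP => [->//|/eqP ji].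
  by apply: wJ; rewrite /= !inE ji.
move=> wJ; split; first by have := wJ i iJ; rewrite /V2 eqxx.
move=> j /=; rewrite !inE => /andP[ji jJ].
by have := wJ j jJ; rewrite /V2 (negbTE ji).
Qed.

Lemma independent_of_pair dW (W : measurableType dW) (A : {mfun T >-> W}) J i :
  independent_of X A J -> i \in J ->
  forall C, measurable C -> P ((fun w => (A w, X i w)) @^-1` C) =
    (distribution P A \x distribution P (X i))%E C.
Proof.
move=> ind iJ C mC.
have mAX : measurable ((fun w => (A w, X i w)) @^-1` C).
  rewrite -[X in measurable X]setTI.
  suff : measurable_fun setT (fun w => (A w, X i w)) by apply.
  by apply/measurable_fun_pairP; split; exact: measurable_funP.
have := independent_of_law ind iJ (V := fun=> setT) mC (fun=> measurableT).
rewrite big1 => [|j _]; last by rewrite preimage_setT probability_setT.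
rewrite mul1e => <-; congr (P _).
by rewrite bigcapT ?setIT //; apply/seteqP; split => w //= wC; split.
Qed.

(** Replaces the grouping of independent variables into blocks: a statistic absorbs the variables
    one at a time, and [op] is the update. *)
Lemma independent_of_step dW dW' (W : measurableType dW)
    (W' : measurableType dW') (A : {mfun T >-> W}) (A' : {mfun T >-> W'}) J i
    (op : W * U -> W') : measurable_fun setT op ->
  independent_of X A J -> i \in J -> (forall w, A' w = op (A w, X i w)) ->
  independent_of X A' (J :\ i).
Proof.
move=> mop ind iJ A'E S V mS mV.
have AE : A' @^-1` S = (fun w => (A w, X i w)) @^-1` (op @^-1` S).
  by apply/seteqP; split=> w /=; rewrite A'E.
have mC : measurable (op @^-1` S) by rewrite -[X in measurable X]setTI; exact: mop.
by rewrite AE (independent_of_law ind) // (independent_of_pair ind) // muleC.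
Qed.

Lemma independent_of_integral dW (W : measurableType dW) (A : {mfun T >-> W})
    J i (f : W * U -> \bar R) : independent_of X A J -> i \in J ->
  measurable_fun setT f -> (forall x, 0 <= f x)%E ->
  (\int[P]_w f (A w, X i w) = \int[P]_w \int[P]_w' f (A w, X i w'))%E.
Proof.
move=> ind iJ mf f0.
have mAB : measurable_fun setT (fun w => (A w, X i w)).
  by apply/measurable_fun_pairP; split; exact: measurable_funP.
pose AB : {mfun T >-> (W * U)%type} := HB.pack (fun w => (A w, X i w))
  (isMeasurableFun.Build _ _ _ _ _ mAB).
rewrite -[LHS](@ge0_integral_distribution _ _ _ _ _ P AB f) //.
rewrite (eq_measure_integral (distribution P A \x distribution P (X i))%E).
  rewrite fubini_tonelli1 // ge0_integral_distribution //=.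
  - apply: eq_integral => w _; rewrite /fubini_F.
    rewrite ge0_integral_distribution //.
    by apply: measurableT_comp => //; exact: measurable_pair1.
  - exact: measurable_fun_fubini_tonelli_F.
  - by move=> x; exact: integral_ge0.
by move=> C mC _; exact: (independent_of_pair ind iJ mC).
Qed.

End independence.

(** * Row sums *)

(** Values in [0, 1] make all integrability conditions automatic, so Tonelli's identity passes to
    real integrals. *)
Lemma independent_of_Rintegral (R : realType) (dT dU dW : measure_display)
    (T : measurableType dT) (U : measurableType dU) (W : measurableType dW)
    (P : probability T R) (I : finType) (X : I -> {RV P >-> U})
    (A : {mfun T >-> W}) (J : {set I}) i (f : W -> U -> R) :
  independent_of X A J -> i \in J ->
  measurable_fun setT (fun z => f z.1 z.2) -> (forall x y, 0 <= f x y <= 1) ->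
  let G w := \int[P]_w' f (A w) (X i w') in
  P.-integrable setT (EFin \o G) /\
  \int[P]_w f (A w) (X i w) = \int[P]_w G w.
Proof.
move=> ind iJ mf f01 G.
have mfE : measurable_fun setT (fun z : W * U => (f z.1 z.2)%:E).
  exact/measurable_EFinP.
have f0 (z : W * U) : (0 <= (f z.1 z.2)%:E)%E.
  by rewrite lee_fin; case/andP: (f01 z.1 z.2).
have mfA w : measurable_fun setT (fun w' => f (A w) (X i w')).
  have mg : measurable_fun setT (fun w' => (A w, X i w')).
    by apply/measurable_fun_pairP; split; [exact: measurable_cst|exact: measurable_funP].
  exact: (measurableT_comp mf mg).
have ifA w : P.-integrable setT (EFin \o (fun w' => f (A w) (X i w'))).
  apply: (@integrable_boundr _ _ _ P _ 1) => // w'.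
  by case/andP: (f01 (A w) (X i w')) => ? ?; rewrite ger0_norm.
have GE w : (\int[P]_w' (f (A w) (X i w'))%:E)%E = (G w)%:E.
  by rewrite /G /Rintegral fineK //; exact: integrable_fin_num (ifA w).
split.
  apply: (@integrable_boundr _ _ _ P _ 1).
    apply/measurable_EFinP; have -> : EFin \o G =
        (fubini_F (distribution P (X i)) (fun z : W * U => (f z.1 z.2)%:E)) \o A.
      apply/funext => w /=; rewrite -GE /fubini_F ge0_integral_distribution //.
      exact: (measurableT_comp mfE (pair1_measurable (A w))).
    apply: measurableT_comp => //; exact: measurable_fun_fubini_tonelli_F.
  move=> w; rewrite ger0_norm; last first.
    by apply: Rintegral_ge0 => w' _; case/andP: (f01 (A w) (X i w')).
  rewrite -[leRHS](Rintegral_cstr P); apply: le_Rintegral => //.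
    exact: integrable_cstr.
  by move=> w' _; case/andP: (f01 (A w) (X i w')).
rewrite /Rintegral; congr fine.
rewrite (independent_of_integral ind iJ mfE f0).
by apply: eq_integral => w _; exact: GE.
Qed.

Lemma same_distribution_Rintegral (R : realType) (dT dU : measure_display)
    (T : measurableType dT) (U : measurableType dU) (P : probability T R)
    (X Y : {RV P >-> U}) (f : U -> R) : same_distribution X Y ->
  measurable_fun setT f -> (forall x, 0 <= f x) ->
  \int[P]_w f (X w) = \int[P]_w f (Y w).
Proof.
move=> XY mf f0; rewrite /Rintegral; congr fine.
have mfE : measurable_fun setT (EFin \o f) by exact/measurable_EFinP.
have f0E x : (0 <= (EFin \o f) x)%E by rewrite lee_fin.
rewrite -[LHS](@ge0_integral_distribution _ _ _ _ _ P X _ mfE f0E).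
rewrite -[RHS](@ge0_integral_distribution _ _ _ _ _ P Y _ mfE f0E).
by apply: eq_measure_integral => A mA _; exact: XY.
Qed.

Section row.
Context {R : realType} {d : nat} {dT : measure_display} {T : measurableType dT}
  (P : probability T R) (n : nat) (X : nat -> {RV P >-> borel_rV R d}).
Hypotheses (n0 : (0 < n)%N) (hiid : iid (fun i : 'I_n => X i.+1)).
Variable O : 'M[R]_d.

Lemma measurable_coord k :
  measurable_fun setT (fun u : borel_rV R d => (u : 'rV[R]_d) ord0 k).
Proof.
apply: (measurability _ (RGenOpens.measurableE R)).
move=> _ [_ [a [b ->] <-]]; rewrite setTI; apply: sub_sigma_algebra.
have /continuousP := @coord_continuous R 1 d ord0 k; apply.
exact: interval_open.
Qed.

Definition rotated_coord (j : 'I_d) (u : borel_rV R d) : R :=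
  \sum_k (u : 'rV[R]_d) ord0 k * O j k.

Lemma measurable_rotated_coord j : measurable_fun setT (rotated_coord j).
Proof.
apply: measurable_sum => k; apply: measurable_funM => //.
exact: measurable_coord.
Qed.

Let h : R := n%:R^-1.

(** A tuple rather than a row vector: on tuples measurability can be checked coordinate by
    coordinate. The scaling is that of the full row for every [k]. *)
Definition partial_sum k (w : T) : d.-tuple R :=
  [tuple Num.sqrt h * \sum_(i < k) rotated_coord j (X i.+1 w) | j < d].

Lemma measurable_partial_sum k : measurable_fun setT (partial_sum k).
Proof.
apply/measurable_fun_tnthP => j.
rewrite (_ : _ \o _ = (fun w => Num.sqrt h * \sum_(i < k) rotated_coord j (X i.+1 w))).
  apply: measurable_funM => //; apply: measurable_sum => i.
  by apply: measurableT_comp; [exact: measurable_rotated_coord|exact: measurable_funP].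
by apply/funext => w; rewrite /= tnth_mktuple.
Qed.

Definition row_sum k : {mfun T >-> (d.-tuple R)%type} :=
  HB.pack (partial_sum k)
    (isMeasurableFun.Build _ _ _ _ _ (measurable_partial_sum k)).

Let add_rotated (z : d.-tuple R * borel_rV R d) : d.-tuple R :=
  [tuple tnth z.1 j + Num.sqrt h * rotated_coord j z.2 | j < d].

Let measurable_add_rotated : measurable_fun setT add_rotated.
Proof.
apply/measurable_fun_tnthP => j.
rewrite (_ : _ \o _ = (fun z => tnth z.1 j + Num.sqrt h * rotated_coord j z.2)).
  apply: measurable_funD.
    exact: (measurableT_comp (measurable_tnth j) measurable_fst).
  apply: measurable_funM => //.
  exact: (measurableT_comp (measurable_rotated_coord j) measurable_snd).
by apply/funext => w; rewrite /= tnth_mktuple.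
Qed.

Lemma partial_sumS k w :
  partial_sum k.+1 w = add_rotated (partial_sum k w, X k.+1 w).
Proof.
by apply: eq_from_tnth => j; rewrite !tnth_mktuple /= big_ord_recr /= mulrDr.
Qed.

(** Ordinal [i] stands for [X i.+1], so the set collects the variables not yet summed; passing from
    [k] to [k.+1] absorbs [X k.+1]. *)
Lemma independent_partial_sum k : (k <= n)%N ->
  independent_of (fun i : 'I_n => X i.+1) (row_sum k)
    [set i : 'I_n | (k <= i)%N].
Proof.
elim: k => [|k IH] kn.
  have [indX _] := hiid.
  apply: (@independent_of_cst R dT _ T _ P _ (fun i : 'I_n => X i.+1) _ _
    (row_sum 0) [tuple 0 | j < d] _ indX) => w.
  by apply: eq_from_tnth => j; rewrite !tnth_mktuple big_ord0 mulr0.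
have := independent_of_step (i := Ordinal kn)
  (A' := row_sum k.+1) measurable_add_rotated (IH (ltnW kn)).
rewrite inE /= leqnn => /(_ isT (partial_sumS k)).
congr independent_of; apply/setP => i; rewrite !inE -val_eqE /=.
by rewrite ltn_neqAle eq_sym.
Qed.

Variables (s : R) (mu : 'I_d -> R) (delta : R).
Hypotheses (s0 : 0 <= s) (mu0 : forall j, 0 <= mu j).
Local Notation v := (heat s mu).

Hypothesis one_step : forall t x, 0 <= t ->
  `|\int[P]_w v t (fun j => x j + Num.sqrt h * rotated_coord j (X 1%N w)) - v (t + h) x|
    <= h * delta.

(** Induction for all [t] at once: integrating out the last summand trades it for an extra time [h],
    and the induction hypothesis is applied at t + h. The one-step error is uniform in the starting
    point, so it survives integration over the earlier summands. *)
Lemma heat_partial_sum k t : (k <= n)%N -> 0 <= t ->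
  `|\int[P]_w v t (tnth (partial_sum k w)) - v (t + k%:R * h) (fun=> 0)|
    <= k%:R * (h * delta).
Proof.
elim: k t => [|k IH] t kn t0.
  rewrite !mul0r addr0 (_ : (fun w => _) = (fun=> v t (fun=> 0))).
    by rewrite Rintegral_cstr subrr normr0.
  apply/funext => w; congr v; apply/funext => j.
  by rewrite tnth_mktuple big_ord0 mulr0.
pose f (z : d.-tuple R) (u : borel_rV R d) :=
  v t (fun j => tnth z j + Num.sqrt h * rotated_coord j u).
have mheat t' (W : measurableType _) (g : 'I_d -> W -> R) :
    (forall j, measurable_fun setT (g j)) ->
    measurable_fun setT (fun z => v t' (fun j => g j z)).
  move=> mg; apply: measurableT_comp => //; apply: measurableT_comp => //.
  apply: measurable_sum => j; apply: measurable_funM => //.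
  apply: measurable_funD => //; apply: measurable_funM => //.
  exact: measurable_funX.
have mf : measurable_fun setT (fun z => f z.1 z.2).
  apply: mheat => j; apply: measurable_funD.
    exact: (measurableT_comp (measurable_tnth j) measurable_fst).
  apply: measurable_funM => //.
  exact: (measurableT_comp (measurable_rotated_coord j) measurable_snd).
have f01 z u : 0 <= f z u <= 1 by rewrite heat_ge0 heat_le1.
have ind := independent_partial_sum (ltnW kn).
have iJ : Ordinal kn \in [set i : 'I_n | (k <= i)%N]%SET by rewrite inE /=.
have [iG e] := independent_of_Rintegral ind iJ mf f01.
have -> : \int[P]_w v t (tnth (partial_sum k.+1 w)) =
    \int[P]_w f (row_sum k w) (X k.+1 w).
  apply: eq_Rintegral => w _; congr v; apply/funext => j.
  by rewrite partial_sumS tnth_mktuple.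
rewrite [X in X - _]e.
have th0 : 0 <= t + h by rewrite addr_ge0 // invr_ge0.
have := IH (t + h) (ltnW kn) th0.
have -> : t + h + k%:R * h = t + k.+1%:R * h by rewrite -natr1; ring.
set I2 := \int[P]_w v (t + h) _ => H2.
have H1 : `|\int[P]_w (\int[P]_w' f (row_sum k w) (X k.+1 w')) - I2| <= h * delta.
  rewrite -[leRHS](Rintegral_cstr P); apply: le_dist_Rintegral => //.
  - apply: (@integrable_boundr _ _ _ P _ 1).
      apply: mheat => j.
      exact: (measurableT_comp (measurable_tnth j) (measurable_partial_sum k)).
    by move=> w; rewrite ger0_norm ?heat_ge0 // heat_le1.
  - exact: integrable_cstr.
  (* Equal laws carry the one-step estimate from [X 1] to [X k.+1]. *)
  - move=> w; have [_ /(_ (Ordinal n0) (Ordinal kn)) same] := hiid.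
    have mfw : measurable_fun setT (f (row_sum k w)).
      apply: mheat => j; apply: measurable_funD => //; apply: measurable_funM => //.
      exact: measurable_rotated_coord.
    have fw0 u : 0 <= f (row_sum k w) u by rewrite heat_ge0.
    have E := same_distribution_Rintegral same mfw fw0.
    by rewrite -[X in `|X - _|]E; exact: one_step.
set I1 := \int[P]_w _ in H1 *.
rewrite (_ : I1 - _ = (I1 - I2) + (I2 - v (t + k.+1%:R * h) (fun=> 0))); last by ring.
apply: le_trans (ler_normD _ _) _; apply: le_trans (lerD H1 H2) _.
by rewrite -natr1 le_eqVlt; apply/orP; left; apply/eqP; ring.
Qed.

End row.

Lemma enorm_sqr (R : realType) d (x : 'rV[R]_d) :
  enorm x ^+ 2 = \sum_j x ord0 j ^+ 2.
Proof. by rewrite sqr_sqrtr // sumr_ge0 // => j _; exact: sqr_ge0. Qed.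

Lemma rotated_coordE (R : realType) d (O : 'M[R]_d) j (u : 'rV[R]_d) :
  rotated_coord O j u = (u *m O^T) ord0 j.
Proof. by rewrite mxE; apply: eq_bigr => k _; rewrite mxE. Qed.

Lemma sum_rotated_coord_sqr (R : realType) d (O : 'M[R]_d) (u : 'rV[R]_d) :
  O *m O^T = 1%:M -> \sum_j rotated_coord O j u ^+ 2 = \sum_j u ord0 j ^+ 2.
Proof.
move=> OO; have e (x : 'rV[R]_d) : \sum_j x ord0 j ^+ 2 = (x *m x^T) ord0 ord0.
  by rewrite mxE; apply: eq_bigr => j _; rewrite mxE expr2.
under eq_bigr do rewrite rotated_coordE.
by rewrite !e trmx_mul trmxK mulmxA -(mulmxA u) (mulmx1C OO) mulmx1.
Qed.

(** * Moments of the rotated vectors *)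

Section moments.
Context {R : realType} {d : nat} {dT : measure_display} {T : measurableType dT}
  (P : probability T R) (X : {RV P >-> borel_rV R d}) (O : 'M[R]_d).
Hypothesis OO : O *m O^T = 1%:M.
Hypothesis hmean : forall j : 'I_d, 'E_P[rv_coord X j]%E = 0%E.
Hypothesis hmom2 : ('E_P[fun w => (enorm (X w) ^+ 2)%R] < +oo)%E.

Let Y j w := rotated_coord O j (X w).

Lemma measurable_rv_coord j : measurable_fun setT (rv_coord X j).
Proof. exact: (measurableT_comp (measurable_coord j) (measurable_funP X)). Qed.

Lemma integrable_enorm2 :
  P.-integrable setT (EFin \o (fun w => enorm (X w) ^+ 2)).
Proof.
have m : measurable_fun setT (fun w => enorm (X w) ^+ 2).
  under eq_fun do rewrite enorm_sqr.
  apply: measurable_sum => j; apply: measurable_funX.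
  exact: measurable_rv_coord.
apply/integrableP; split; first exact/measurable_EFinP.
move: hmom2; rewrite unlock => lty.
rewrite (eq_integral (fun w => (enorm (X w) ^+ 2)%:E)) // => w _ /=.
by rewrite ger0_norm // sqr_ge0.
Qed.

Lemma coord_sqr_le j w : rv_coord X j w ^+ 2 <= enorm (X w) ^+ 2.
Proof.
rewrite enorm_sqr (bigD1 j) //= lerDl sumr_ge0 // => k _; exact: sqr_ge0.
Qed.

Lemma integrable_coordM j k :
  P.-integrable setT (EFin \o (fun w => rv_coord X j w * rv_coord X k w)).
Proof.
apply: integrable_ler integrable_enorm2 => [|w].
  by apply: measurable_funM; exact: measurable_rv_coord.
have := coord_sqr_le j w; have := coord_sqr_le k w; rewrite normrM.
rewrite -[rv_coord X j w ^+ 2]real_normK ?num_real //.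
rewrite -[rv_coord X k w ^+ 2]real_normK ?num_real //.
have := sqr_ge0 (`|rv_coord X j w| - `|rv_coord X k w|); rewrite sqrrB; lra.
Qed.

Lemma integrable_coord j : P.-integrable setT (EFin \o rv_coord X j).
Proof.
have := integrable_addr (integrable_cstr P 1) integrable_enorm2.
apply: integrable_ler => [|w /=]; first exact: measurable_rv_coord.
have := coord_sqr_le j w; rewrite -[rv_coord X j w ^+ 2]real_normK ?num_real //.
have := sqr_ge0 `|rv_coord X j w|.
have := sqr_ge0 (`|rv_coord X j w| - 1); rewrite sqrrB; lra.
Qed.

Lemma Rintegral_coord j : \int[P]_w rv_coord X j w = 0.
Proof. by rewrite /Rintegral; have := hmean j; rewrite unlock => ->. Qed.

Lemma Rintegral_coordM j k :
  \int[P]_w (rv_coord X j w * rv_coord X k w) = cov_mx P X j k.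
Proof.
rewrite mxE unlock !hmean /= /Rintegral unlock; congr fine.
apply: eq_integral => w _ /=.
by rewrite -[RHS]/(((rv_coord X j w - 0) * (rv_coord X k w - 0))%:E) !subr0.
Qed.

Lemma measurable_rot j : measurable_fun setT (Y j).
Proof. exact: (measurableT_comp (measurable_rotated_coord O j) (measurable_funP X)). Qed.

Lemma integrable_rot j : P.-integrable setT (EFin \o Y j).
Proof.
apply: integrable_sumr => k.
under [fun w => _]funext do rewrite mulrC.
exact/integrable_scaler/integrable_coord.
Qed.

Let rotME j k w : Y j w * Y k w =
  \sum_a \sum_b O j a * O k b * (rv_coord X a w * rv_coord X b w).
Proof.
rewrite /Y /rotated_coord big_distrlr /=; apply: eq_bigr => a _; apply: eq_bigr => b _.
by rewrite /rv_coord; ring.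
Qed.

Lemma integrable_rotM j k :
  P.-integrable setT (EFin \o (fun w => Y j w * Y k w)).
Proof.
under [fun w => _]funext do rewrite rotME.
do 2 (apply: integrable_sumr => ?).
exact/integrable_scaler/integrable_coordM.
Qed.

Lemma Rintegral_rot j : \int[P]_w Y j w = 0.
Proof.
have ik k : P.-integrable setT (EFin \o (fun w => O j k * rv_coord X k w)).
  exact/integrable_scaler/integrable_coord.
transitivity (\int[P]_w (\sum_k O j k * rv_coord X k w)).
  by apply: eq_Rintegral => w _; apply: eq_bigr => k _; rewrite mulrC.
rewrite Rintegral_sumr //; apply: big1 => k _.
by rewrite RintegralZl ?Rintegral_coord ?mulr0 //; exact: integrable_coord.
Qed.

Lemma Rintegral_rotM j k :
  \int[P]_w (Y j w * Y k w) = (O *m cov_mx P X *m O^T) j k.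
Proof.
have iab a b : P.-integrable setT
    (EFin \o (fun w => O j a * O k b * (rv_coord X a w * rv_coord X b w))).
  exact/integrable_scaler/integrable_coordM.
under eq_Rintegral do rewrite rotME.
rewrite Rintegral_sumr => [|a]; last exact: integrable_sumr.
rewrite mxE; under [RHS]eq_bigr do rewrite mxE mulr_suml.
rewrite [RHS]exchange_big /=; apply: eq_bigr => a _.
rewrite Rintegral_sumr //; apply: eq_bigr => b _.
rewrite RintegralZl ?Rintegral_coordM //; last exact: integrable_coordM.
have -> : O^T b k = O k b by rewrite mxE.
by ring.
Qed.

End moments.

Lemma enormZ_sqr (R : realType) d (a : R) (x : 'rV[R]_d) :
  enorm (a *: x) ^+ 2 = a ^+ 2 * enorm x ^+ 2.
Proof.
by rewrite !enorm_sqr mulr_sumr; apply: eq_bigr => j _; rewrite mxE exprMn.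
Qed.

(** * Laplace transform of a single row *)

Section row_laplace.
Context {R : realType} {d : nat} {dT : measure_display} {T : measurableType dT}
  (P : probability T R) (n : nat) (X : nat -> {RV P >-> borel_rV R d}).
Hypotheses (n0 : (0 < n)%N) (hiid : iid (fun i : 'I_n => X i.+1)).
Hypothesis hmean : forall j : 'I_d, 'E_P[rv_coord (X 1%N) j]%E = 0%E.
Hypothesis hmom2 : ('E_P[fun w => (enorm (X 1%N w) ^+ 2)%R] < +oo)%E.
Variables (O : 'M[R]_d) (s : R) (mu : 'I_d -> R).
Hypothesis OO : O *m O^T = 1%:M.
Hypotheses (s0 : 0 <= s) (mu0 : forall j, 0 <= mu j).

Lemma row_statE w : row_stat n (fun i => X i) w =
  \sum_j tnth (partial_sum n X O n w) j ^+ 2.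
Proof.
under [RHS]eq_bigr do rewrite tnth_mktuple exprMn.
rewrite -mulr_sumr sqr_sqrtr ?invr_ge0 // /row_stat /row_mean enormZ_sqr.
have nn : n%:R != 0 :> R by rewrite pnatr_eq0 -lt0n.
rewrite (_ : n%:R * _ = n%:R^-1 * enorm (\sum_(1 <= i < n.+1) X i w) ^+ 2); last first.
  by field.
rewrite enorm_sqr -(sum_rotated_coord_sqr _ OO); congr (_ * _); apply: eq_bigr => j _.
congr (_ ^+ 2); rewrite rotated_coordE mulmx_suml summxE big_add1 big_mkord.
by apply: eq_bigr => i _; rewrite rotated_coordE.
Qed.

(** [heat] at time 0 is the test function, and at time n h = 1 and the origin it is the limiting
    transform. The n errors of size delta / n add up to delta, where [eps] and [eta] are still
    free. *)
Lemma row_laplace (eps eta : R) : 0 <= eps -> 0 <= eta ->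
  (forall j k, `|(O *m cov_mx P (X 1%N) *m O^T) j k - (j == k)%:R * mu j| <= eta) ->
  `|\int[P]_w expR (- (s / 2 * row_stat n (fun i => X i) w))
     - expR (- (\sum_j ln (1 + s * mu j) / 2))| <=
  20 * s * (Num.sqrt s * eps * (\sum_j mu j + d%:R * eta)
     + fine (truncated_moment2 P (X 1%N) (Num.sqrt n%:R * eps)))
    + 2 * eta * d%:R * s + 8 * (s * \sum_j mu j) ^+ 2 * n%:R^-1.
Proof.
move=> eps0 eta0 covP.
set delta := (X in _ <= X).
have step t x : 0 <= t ->
  `|\int[P]_w heat s mu t (fun j => x j + Num.sqrt n%:R^-1 * rotated_coord O j (X 1%N w))
     - heat s mu (t + n%:R^-1) x| <= n%:R^-1 * delta.
  move=> t0; have H := heat_one_step s0 mu0 (measurable_rot (X 1%N) O)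
    (integrable_rot O hmom2) (integrable_rotM O hmom2)
    (Rintegral_rot O hmean hmom2) (Rintegral_rotM O hmean hmom2)
    x t0 n0 eps0 eta0 covP.
  apply: (H _ _ erefl).
  rewrite /truncated_moment2 unlock /Rintegral; congr fine.
  apply: eq_integral => w _.
  rewrite enorm_sqr sum_rotated_coord_sqr //; congr (_ * \1_ _ _)%:E.
  by apply/seteqP; split => w' /=; rewrite sum_rotated_coord_sqr.
have := heat_partial_sum n0 hiid s0 mu0 step (leqnn n) (lexx 0).
have nn : n%:R != 0 :> R by rewrite pnatr_eq0 -lt0n.
rewrite add0r mulrA divff // mul1r.
rewrite (_ : heat s mu 1 (fun=> 0) = expR (- (\sum_j ln (1 + s * mu j) / 2))); last first.
  rewrite /heat /heat_exponent; congr (expR (- _)); apply: eq_bigr => j _.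
  by rewrite expr0n /= mulr0 addr0 mul1r.
rewrite (_ : \int[P]_w heat s mu 0 _ =
  \int[P]_w expR (- (s / 2 * row_stat n (fun i => X i) w))) //.
apply: eq_Rintegral => w _; rewrite row_statE /heat /heat_exponent.
congr (expR (- _)); rewrite mulr_sumr; apply: eq_bigr => j _.
rewrite /heat_coef !mul0r addr0 ln1 add0r divr1; ring.
Qed.

End row_laplace.

Lemma cvg_conjmx (R : realType) d (O : 'M[R]_d) (C : nat -> 'M[R]_d)
    (A : 'M[R]_d) j k :
  (forall j k, C n j k @[n --> \oo] --> A j k) ->
  (O *m C n *m O^T) j k @[n --> \oo] --> (O *m A *m O^T) j k.
Proof.
move=> CA.
have e (B : 'M[R]_d) : (O *m B *m O^T) j k =
    \sum_b \sum_a O j a * O k b * B a b.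
  rewrite mxE; apply: eq_bigr => b _; rewrite !mxE mulr_suml.
  by apply: eq_bigr => a _; rewrite mulrAC.
rewrite e; under eq_fun do rewrite e.
do 2 (apply: cvg_big => [|? _]; first exact: add_continuous).
exact: cvgMl_tmp.
Qed.

(** * Limit of the Laplace transforms *)

Section laplace_limit.
Context {R : realType} {d : nat} {dT : nat -> measure_display}
  {T : forall n, measurableType (dT n)} (P : forall n, probability (T n) R)
  (X : forall n, nat -> {RV P n >-> borel_rV R d}).
Hypothesis hiid : forall n, (0 < n)%N -> iid (fun i : 'I_n => X n i.+1).
Hypothesis hmean : forall n, (0 < n)%N ->
  forall j : 'I_d, 'E_(P n)[rv_coord (X n 1%N) j]%E = 0%E.
Hypothesis hmom2 : forall n, (0 < n)%N ->
  ('E_(P n)[fun w => (enorm (X n 1%N w) ^+ 2)%R] < +oo)%E.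
Variable Gamma : 'M[R]_d.
Hypothesis hcov : forall j k : 'I_d,
  cov_mx (P n) (X n 1%N) j k @[n --> \oo] --> Gamma j k.
Hypothesis hlind : forall eps : rat, 0 < eps ->
  truncated_moment2 (P n) (X n 1%N) (Num.sqrt n%:R * ratr eps)
    @[n --> \oo] --> 0%E.

Lemma limit_cov_symmetric : Gamma^T = Gamma.
Proof.
apply/matrixP => j k; rewrite mxE.
have h : cov_mx (P n) (X n 1%N) j k @[n --> \oo] --> Gamma k j.
  rewrite (_ : (fun n => _) = (fun n => cov_mx (P n) (X n 1%N) k j)) //.
  by apply/funext => n; rewrite !mxE covarianceC.
exact: (cvg_unique _ h (@hcov j k)).
Qed.

Variables (O : 'M[R]_d) (D : 'rV[R]_d).
Hypothesis OO : O *m O^T = 1%:M.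
Hypothesis OGO : O *m Gamma *m O^T = diag_mx D.

(** The entry is a limit of second moments of a rotated coordinate. *)
Lemma limit_cov_diag_ge0 j : 0 <= D ord0 j.
Proof.
have := cvg_conjmx (O := O) (j := j) (k := j) hcov.
rewrite OGO mxE eqxx mulr1n => /cvgr_to_ge; apply.
near=> n.
have n0 : (0 < n)%N by near: n; exact: nbhs_infty_gt.
rewrite -(Rintegral_rotM O (hmean n0) (hmom2 n0)).
by apply: Rintegral_ge0 => w _; rewrite -expr2 sqr_ge0.
Unshelve. all: by end_near. Qed.

Lemma row_laplace_cvg (s : R) : 0 <= s ->
  \int[P n]_w expR (- (s / 2 * row_stat n (fun i => X n i) w)) @[n --> \oo]
  --> expR (- (\sum_j ln (1 + s * D ord0 j) / 2)).
Proof.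
move=> s0; apply/cvgrPdist_le => e e0.
pose M := s * \sum_j D ord0 j.
(* With eps = eta = q <= 1, and q replaced by 1 in the inner sum, the terms without L and 1/n are at
   most K q. *)
pose K := 20 * s * Num.sqrt s * (\sum_j D ord0 j + d%:R) + 2 * d%:R * s.
have D0 := limit_cov_diag_ge0.
have SD : 0 <= \sum_j D ord0 j by exact: sumr_ge0.
have K0 : 0 <= K.
  by rewrite addr_ge0 ?mulr_ge0 ?addr_ge0 ?sqrtr_ge0.
have K1 : 0 < 3 * (K + 1) by rewrite mulr_gt0 // ltr_wpDl.
have : 0 < Num.min 1 (e / (3 * (K + 1))) by rewrite lt_min ltr01 divr_gt0.
(* One rational q serves both as truncation level, where the Lindeberg hypothesis is available, and
   as bound on the entries of the covariance error. *)
move=> /rat_in_itvoo[q]; rewrite in_itv /= lt_min => /and3P[q0 q1 qe].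
have q0' : 0 < q by move: q0; rewrite ltr0q.
have qK : K * ratr q <= e / 3.
  move: qe; rewrite ltr_pdivlMr // => qe.
  rewrite ler_pdivlMr //; apply: le_trans (ltW qe).
  rewrite (_ : K * _ * 3 = ratr q * (3 * K)); last by ring.
  by rewrite ler_wpM2l ?(ltW q0) // ler_wpM2l // lerDl.
have : 0 < e / (3 * (20 * s + 1)).
  by rewrite divr_gt0 // mulr_gt0 // ltr_wpDl // mulr_ge0.
move=> eL0.
have L : fine (truncated_moment2 (P n) (X n 1%N) (Num.sqrt n%:R * ratr q))
    @[n --> \oo] --> (0 : R) by exact: fine_cvg (hlind q0').
have nl := cvgr0_norm_le _ L _ eL0.
near=> n.
have n0 : (0 < n)%N by near: n; exact: nbhs_infty_gt.
have covP j k : `|(O *m cov_mx (P n) (X n 1%N) *m O^T) j k - (j == k)%:R * D ord0 j|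
    <= ratr q.
  rewrite distrC; move: j k; near: n.
  apply: filter_forall => j; apply: filter_forall => k.
  rewrite (_ : (j == k)%:R * D ord0 j = (O *m Gamma *m O^T) j k).
    by apply: cvgr_dist_le (cvg_conjmx (O := O) (j := j) (k := k) hcov) _ _.
  by rewrite OGO mxE mulr_natl.
rewrite distrC.
apply: le_trans (row_laplace n0 (hiid n0) (hmean n0) (hmom2 n0) OO s0 D0
  (ltW q0) (ltW q0) covP) _.
set l := fine _.
have hl : `|l| <= e / (3 * (20 * s + 1)).
  by rewrite /l; near: n; exact: nl.
have hn : 8 * M ^+ 2 * n%:R^-1 <= e / 3.
  rewrite ler_pdivrMr ?ltr0n // (mulrC (e / 3)) -ler_pdivrMr ?divr_gt0 //.
  by near: n; exact: nbhs_infty_ger.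
have h1 : 20 * s * l <= e / 3.
  have s20 : 0 <= 20 * s by rewrite mulr_ge0.
  have s21 : 0 < 20 * s + 1 by rewrite ltr_wpDl.
  move: hl; rewrite ler_pdivlMr ?mulr_gt0 // => hl.
  have ll := ler_norm l; rewrite ler_pdivlMr //.
  have := normr_ge0 l; nra.
have h2 : 20 * s * (Num.sqrt s * ratr q * (\sum_j D ord0 j + d%:R * ratr q))
    + 2 * ratr q * d%:R * s <= e / 3.
  apply: le_trans qK.
  rewrite (_ : K * ratr q = 20 * s * (Num.sqrt s * ratr q *
    (\sum_j D ord0 j + d%:R * 1)) + 2 * ratr q * d%:R * s); last by rewrite /K; ring.
  rewrite lerD2r; apply: ler_wpM2l; first by rewrite mulr_ge0.
  apply: ler_wpM2l; first by rewrite mulr_ge0 ?sqrtr_ge0 ?(ltW q0).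
  by rewrite lerD2l; apply: ler_wpM2l => //; exact: ltW.
rewrite -/M; rewrite mulrDr; lra.
Unshelve. all: by end_near. Qed.

End laplace_limit.

(** * Squares of normal variables *)

Section independent_sum.
Context {R : realType} {dT dU : measure_display} {T : measurableType dT}
  {U : measurableType dU} (P : probability T R) (I : finType)
  (N : I -> {RV P >-> U}) (g : I -> U -> R).
Hypothesis indN : independent N.
Hypothesis mg : forall i, measurable_fun setT (g i).

Lemma measurable_comp_sum (J : {set I}) :
  measurable_fun setT (fun w => \sum_(i in ~: J) g i (N i w)).
Proof.
under eq_fun do rewrite big_mkcond /=.
apply: measurable_sum => i; case: (_ \in _) => //.
exact: (measurableT_comp (mg i) (measurable_funP (N i))).
Qed.

Definition sum_outside (J : {set I}) : {mfun T >-> R} :=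
  HB.pack (fun w => \sum_(i in ~: J) g i (N i w))
    (isMeasurableFun.Build _ _ _ _ _ (@measurable_comp_sum J)).

Lemma sum_outsideD1 (J : {set I}) i w : i \in J ->
  sum_outside (J :\ i) w = sum_outside J w + g i (N i w).
Proof.
move=> iJ /=; rewrite (bigD1 i) /=; last by rewrite !inE eqxx.
rewrite addrC; congr (_ + _); apply: eq_bigl => j; rewrite !inE.
by case: eqVneq => [->|ji] /=; rewrite ?iJ ?andbT.
Qed.

(** Induction on the number of summands, since [i |: J] leaves one summand fewer. *)
Lemma independent_sum_outside (J : {set I}) : independent_of N (sum_outside J) J.
Proof.
have [m] := ubnP #|~: J|; elim: m => // m IH in J *; rewrite ltnS => Jm.
have [J0|[i iJ]] := set_0Vmem (~: J).
  apply: (@independent_of_cst R dT _ T _ P _ N _ _ (sum_outside J) 0 _ indN) => w.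
  by rewrite /= J0 big_set0.
rewrite inE in iJ; have JE : J = (i |: J) :\ i.
  by apply/setP => j; rewrite !inE; case: eqVneq => [->|ji] //=; apply/negbTE.
rewrite {2}JE.
apply: (independent_of_step (A := sum_outside (i |: J)) (i := i)
  (op := fun z : R * U => z.1 + g i z.2)).
- by apply: measurable_funD => //; exact: (measurableT_comp (mg i) measurable_snd).
- apply: IH; apply: leq_trans Jm; apply: proper_card.
  rewrite finset.setCU finset.setIC finset.properEneq finset.subsetIl andbT.
  apply/eqP => e.
  by move: (iJ); rewrite -finset.in_setC -e !inE eqxx ?andbF.
- by rewrite !inE eqxx.
- by move=> w; rewrite {1}JE sum_outsideD1 // !inE eqxx.
Qed.

Lemma laplace_sum_outside (J : {set I}) : (forall i x, 0 <= g i x) ->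
  \int[P]_w expR (- sum_outside J w) =
  \prod_(i in ~: J) \int[P]_w expR (- g i (N i w)).
Proof.
move=> g0; have [m] := ubnP #|~: J|; elim: m => // m IH in J *; rewrite ltnS => Jm.
have [J0|[i iJ]] := set_0Vmem (~: J).
  rewrite J0 big_set0; under eq_Rintegral do rewrite /= J0 big_set0 oppr0 expR0.
  exact: Rintegral_cstr.
rewrite inE in iJ; have JE : J = (i |: J) :\ i.
  by apply/setP => j; rewrite !inE; case: eqVneq => [->|ji] //=; apply/negbTE.
have iiJ : i \in i |: J by rewrite !inE eqxx.
have S0 w : 0 <= sum_outside (i |: J) w by apply: sumr_ge0.
(* The absolute value keeps f in [0, 1] for every real x; it changes nothing at the sums, which are
   nonnegative. *)
pose f (x : R) (u : U) := expR (- `|x|) * expR (- g i u).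
have f01 x u : 0 <= f x u <= 1.
  rewrite mulr_ge0 ?expR_ge0 //= -[leRHS]mulr1.
  by apply: ler_pM; rewrite ?expR_ge0 // expR_le1 oppr_le0.
have mf : measurable_fun setT (fun z => f z.1 z.2).
  apply: measurable_funM; apply: measurableT_comp => //.
    by apply: measurableT_comp => //; apply: measurableT_comp.
  by apply: measurableT_comp => //; exact: (measurableT_comp (mg i) measurable_snd).
have [_ e] := independent_of_Rintegral (independent_sum_outside (i |: J)) iiJ mf f01.
transitivity (\int[P]_w f (sum_outside (i |: J) w) (N i w)).
  apply: eq_Rintegral => w _; rewrite /f ger0_norm // {1}JE sum_outsideD1 //.
  by rewrite opprD expRD.
have mgi : measurable_fun setT (fun w => expR (- g i (N i w))).
  apply: measurableT_comp => //; apply: measurableT_comp => //.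
  exact: (measurableT_comp (mg i) (measurable_funP (N i))).
have mS : measurable_fun setT (fun w => expR (- sum_outside (i |: J) w)).
  by apply: measurableT_comp => //; apply: measurableT_comp.
have bounded_exp (h : T -> R) : measurable_fun setT (fun w => expR (- h w)) ->
    (forall w, 0 <= h w) -> P.-integrable setT (EFin \o (fun w => expR (- h w))).
  move=> mh h0; apply: (@integrable_boundr _ _ _ P _ 1) => // w.
  by rewrite ger0_norm ?expR_ge0 // expR_le1 oppr_le0.
rewrite e; transitivity (\int[P]_w (expR (- sum_outside (i |: J) w) *
    \int[P]_w' expR (- g i (N i w')))).
  apply: eq_Rintegral => w _; rewrite /f RintegralZl //.
    by rewrite ger0_norm.
  exact: bounded_exp.
rewrite RintegralZr //; last exact: bounded_exp.
rewrite IH; last first.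
  apply: leq_trans Jm; apply: proper_card.
  rewrite finset.setCU finset.setIC finset.properEneq finset.subsetIl andbT.
  apply/eqP => E.
  by move: (iJ); rewrite -finset.in_setC -E !inE eqxx ?andbF.
rewrite [RHS](bigD1 i) ?inE //= mulrC; congr (_ * _).
by apply: eq_bigl => j; rewrite !inE negb_or andbC.
Qed.

End independent_sum.

Section normal_square.
Context {R : realType}.
Local Notation leb := (@lebesgue_measure R).

(** The Radon-Nikodym derivative and the normal density have the same integral over every measurable
    set, hence agree almost everywhere. *)
Lemma ge0_integral_normal_prob (f : R -> \bar R) : measurable_fun setT f ->
  (\int[normal_prob 0 1]_x `|f x| < +oo)%E ->
  (\int[normal_prob 0 1]_x f x = \int[leb]_x (f x * (normal_pdf 0 1 x)%:E))%E.
Proof.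
move=> mf finf.
rewrite -(Radon_Nikodym_change_of_variables
  (normal_prob_dominates (0 : R) 1))//=; last by apply/integrableP; split.
apply: ae_eq_integral => //.
- apply: emeasurable_funM => //; apply: (measurable_int leb).
  by apply: Radon_Nikodym_integrable; exact: normal_prob_dominates.
- apply: emeasurable_funM => //=; apply/measurableT_comp => //=.
  exact: measurable_normal_pdf.
- apply: ae_eqe_mul2l => /=.
  rewrite Radon_NikodymE//=; first exact: normal_prob_dominates.
  move=> abmu; case: cid => /= h [h1 h2 h3].
  apply: integral_ae_eq => //=.
  + by apply/measurable_EFinP; exact: measurable_normal_pdf.
  + by move=> E E01 mE; rewrite -h3.
Qed.

(** The integrand is [sg] times the centered normal density with standard deviation sg = (1 +
    a)^(-1/2), whose total mass is 1. *)
Lemma gaussian_laplace (a : R) : 0 <= a ->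
  (\int[leb]_x ((expR (- (a / 2 * x ^+ 2)))%:E * (normal_pdf 0 1 x)%:E) =
   (expR (- (ln (1 + a) / 2)))%:E)%E.
Proof.
move=> a0; pose sg := expR (- (ln (1 + a) / 2)).
have sg0 : 0 < sg by exact: expR_gt0.
have a1 : 0 < 1 + a by rewrite ltr_wpDr.
have sg2 : sg ^+ 2 = (1 + a)^-1.
  rewrite expr2 -expRD -opprD -splitr expRN lnK //.
transitivity (\int[leb]_x (sg%:E * (normal_pdf 0 sg x)%:E))%E.
  apply: eq_integral => x _; rewrite -!EFinM; congr (_%:E).
  rewrite /normal_pdf oner_eq0 (gt_eqF sg0) /normal_fun /normal_peak !subr0.
  have -> : Num.sqrt (sg ^+ 2 * pi *+ 2) = sg * Num.sqrt (1 ^+ 2 * pi *+ 2).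
    rewrite expr1n mul1r -mulrnAr sqrtrM ?sqr_ge0 //.
    by rewrite sqrtr_sqr ger0_norm // ltW.
  rewrite mulrCA -expRD invfM -(mulrA sg^-1) mulVKf ?gt_eqF //; congr (_ * expR _).
  by rewrite sg2; field; rewrite gt_eqF.
rewrite integralZl //; last exact: integrable_normal_pdf.
by rewrite integral_normal_pdf mule1.
Qed.

Lemma laplace_normal_square (dO : measure_display) (Om : measurableType dO)
    (Q : probability Om R) (N : {RV Q >-> R}) (a : R) : 0 <= a ->
  standard_normal N ->
  \int[Q]_w expR (- (a / 2 * N w ^+ 2)) = expR (- (ln (1 + a) / 2)).
Proof.
move=> a0 stdN; pose f (x : R) := (expR (- (a / 2 * x ^+ 2)))%:E.
have mf : measurable_fun setT f.
  apply/measurable_EFinP; apply: measurableT_comp => //.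
  apply: measurableT_comp => //; apply: measurable_funM => //.
have f0 x : (0 <= f x)%E by rewrite lee_fin expR_ge0.
have e : (\int[Q]_w f (N w) = \int[normal_prob 0 1]_x f x)%E.
  rewrite -[LHS](@ge0_integral_distribution _ _ _ _ _ Q N f) //.
  (* R and measurableTypeR R have the same measurable sets, but different
     displays. *)
  pose idTR : measurableTypeR R -> R := idfun.
  have midTR : measurable_fun [set: measurableTypeR R] idTR.
    by move=> _ A mA; rewrite setTI.
  pose idRV : {mfun measurableTypeR R >-> R} := HB.pack idTR
    (isMeasurableFun.Build _ _ _ _ _ midTR).
  rewrite -[RHS](@ge0_integral_distribution _ _ _ _ _
    (normal_prob (0 : R) 1) idRV f) //.
  by apply: eq_measure_integral => A mA _; exact: stdN.
rewrite /Rintegral [X in fine X]e ge0_integral_normal_prob //.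
  by rewrite gaussian_laplace.
apply: (@le_lt_trans _ _ (\int[normal_prob (0 : R) 1]_x 1)%E).
  apply: ge0_le_integral => //.
  - have mabs : measurable_fun setT (fun x => `|f x|%E).
      exact: measurableT_comp.
    by move=> _ A mA; exact: (mabs measurableT A mA).
  - move=> x _; rewrite gee0_abs // lee_fin expR_le1 oppr_le0.
    by rewrite mulr_ge0 ?sqr_ge0 ?divr_ge0.
rewrite integral_cst // mul1e.
apply: le_lt_trans (ltry _).
exact: (probability_le1 (normal_prob (0 : R) 1) measurableT).
Qed.
End normal_square.

(** * Convergence in distribution from Laplace transforms *)

Lemma expr1B_ge (R : realFieldType) (z : R) M : 0 <= z <= 1 ->
  1 - M%:R * z <= (1 - z) ^+ M.
Proof.
move=> /andP[z0 z1]; elim: M => [|M IH]; first by rewrite mul0r subr0 expr0.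
rewrite exprS; have z1' : 0 <= 1 - z by rewrite subr_ge0.
apply: le_trans (ler_wpM2l z1' IH); rewrite -natr1.
have := mulr_ge0 (ler0n R M) (sqr_ge0 z); lra.
Qed.

(** One factor 1 - z turns 1 + (M + 1) z into at most 1 + M z. The bound (1 - z)^M <= 1 / (1 + M z)
    complements Bernoulli's inequality. *)
Lemma expr1B_le (R : realFieldType) (z : R) M : 0 <= z <= 1 ->
  (1 - z) ^+ M * (1 + M%:R * z) <= 1.
Proof.
move=> /andP[z0 z1]; elim: M => [|M IH]; first by rewrite mul0r addr0 expr0 mulr1.
apply: le_trans IH; rewrite exprSr -mulrA; apply: ler_wpM2l.
  by rewrite exprn_ge0 // subr_ge0.
rewrite -natr1; have := mulr_ge0 (ler0n R M) (sqr_ge0 z); have := sqr_ge0 z; lra.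
Qed.

(* 1 - (1 - y^k)^M approximates the indicator of y >= c when k is large and M is
   close to c^(-k). *)
Lemma threshold_polynomial (R : realType) (c1 c2 e : R) :
  0 < c1 -> c1 < 1 -> c1 < c2 -> 0 < e ->
  exists k M, forall y, 0 <= y <= 1 ->
    (y <= c1 -> 1 - (1 - y ^+ k) ^+ M <= e) /\
    (c2 <= y -> 1 - e <= 1 - (1 - y ^+ k) ^+ M).
Proof.
move=> c10 c11 c12 e0; pose m := (c1 + c2) / 2.
have c1m : c1 < m by rewrite /m; lra.
have mc2 : m < c2 by rewrite /m; lra.
have m0 : 0 < m by exact: lt_trans c1m.
have c20 : 0 < c2 by exact: lt_trans mc2.
have small (r : R) : 0 <= r -> r < 1 -> \forall k \near \oo, r ^+ k <= e / 2.
  move=> r0 r1; have e2 : 0 < e / 2 by rewrite divr_gt0.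
  have r1' : `|r| < 1 by rewrite ger0_norm.
  near=> k; rewrite -[r ^+ k]ger0_norm ?exprn_ge0 //; near: k.
  exact: cvgr0_norm_le (cvg_expr r1') _ e2.
have H : \forall k \near \oo,
    [/\ (c1 / m) ^+ k <= e / 2, c1 ^+ k <= e / 2 & (m / c2) ^+ k <= e / 2].
  near=> k; split; near: k; apply: small.
  - by rewrite divr_ge0 // ltW.
  - by rewrite ltr_pdivrMr // mul1r.
  - exact: ltW.
  - by [].
  - by rewrite divr_ge0 // ltW.
  - by rewrite ltr_pdivrMr // mul1r.
have [k [h1 h2 h3]] := filter_ex H.
have mk0 : 0 < m ^+ k by rewrite exprn_gt0.
(* [M] lies between m^(-k) and m^(-k) + 1. For y <= c1, Bernoulli bounds the value by M y^k <=
   (c1/m)^k + c1^k. For y >= c2, M y^k >= (c2/m)^k, so (1 - y^k)^M <= (m/c2)^k. *)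
pose M := (Num.truncn (m ^- k)).+1.
have Mlo : m ^- k <= M%:R by apply: ltW; rewrite truncnS_gt.
have Mhi : M%:R <= m ^- k + 1.
  by rewrite -natr1 lerD2r truncn_le // invr_ge0 ltW.
exists k, M => y /andP[y0 y1].
have yk0 : 0 <= y ^+ k by rewrite exprn_ge0.
have yk : 0 <= y ^+ k <= 1 by rewrite yk0 exprn_ile1.
split=> [yc|yc].
  rewrite lerBlDr -lerBlDl; apply: le_trans (expr1B_ge M yk).
  rewrite lerD2l lerN2.
  apply: (@le_trans _ _ ((m ^- k + 1) * c1 ^+ k)).
    by apply: ler_pM => //; rewrite lerXn2r ?nnegrE // ltW.
  by rewrite mulrDl mul1r mulrC -expr_div_n; lra.
rewrite lerD2l lerN2.
have c2k : 0 < c2 ^+ k by rewrite exprn_gt0.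
have B0 : 0 <= (1 - y ^+ k) ^+ M by rewrite exprn_ge0 // subr_ge0; case/andP: yk.
have big : (c2 / m) ^+ k <= M%:R * y ^+ k.
  rewrite expr_div_n mulrC; apply: ler_pM => //.
  - by rewrite invr_ge0 ltW.
  - exact: ltW.
  - by rewrite lerXn2r ?nnegrE // ltW.
have q0 : 0 < (c2 / m) ^+ k by rewrite exprn_gt0 // divr_gt0.
have h3' : 1 <= e / 2 * (c2 / m) ^+ k.
  move: h3; rewrite -[m / c2]invf_div exprVn => h3.
  by rewrite -ler_pdivrMr // div1r.
have := expr1B_le M yk; set B := _ ^+ M in B0 *; set z := _ * y ^+ k in big * => hB.
have : B * (c2 / m) ^+ k <= 1.
  by apply: le_trans hB; apply: ler_wpM2l => //; lra.
move=> hB'; rewrite -(ler_pM2r q0); apply: le_trans hB' _; nra.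
Unshelve. all: by end_near. Qed.

Section continuity_theorem.
Context {R : realType}.

Lemma dist_fun_Rintegral (dT : measure_display) (T : measurableType dT)
    (P : probability T R) (V : T -> R) x : measurable_fun setT V ->
  dist_fun P V x = \int[P]_w \1_[set w | V w <= x] w.
Proof.
move=> mV; rewrite /dist_fun /Rintegral; congr fine.
rewrite integral_indic ?setIT //.
by rewrite -[X in measurable X]setTI; exact: measurable_fun_le.
Qed.

Lemma measurable_le_set (dT : measure_display) (T : measurableType dT)
    (V : T -> R) x : measurable_fun setT V -> measurable [set w | V w <= x].
Proof.
by move=> mV; rewrite -[X in measurable X]setTI; exact: measurable_fun_le.
Qed.

Lemma dist_fun_ge0 (dT : measure_display) (T : measurableType dT)
    (P : probability T R) (V : T -> R) x : 0 <= dist_fun P V x.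
Proof. exact: fine_ge0. Qed.

Lemma dist_fun_le1 (dT : measure_display) (T : measurableType dT)
    (P : probability T R) (V : T -> R) x : measurable_fun setT V ->
  dist_fun P V x <= 1.
Proof.
move=> mV; have mx := measurable_le_set x mV.
by rewrite -lee_fin fineK ?fin_num_measure // probability_le1.
Qed.

Lemma dist_fun_nondecreasing (dT : measure_display) (T : measurableType dT)
    (P : probability T R) (V : T -> R) : measurable_fun setT V ->
  {homo dist_fun P V : x y / x <= y}.
Proof.
move=> mV x y xy; rewrite /dist_fun fine_le //.
- exact: fin_num_measure (measurable_le_set x mV).
- exact: fin_num_measure (measurable_le_set y mV).
apply: le_measure; rewrite ?inE; do ?exact: measurable_le_set.
by move=> w /= /le_trans; apply.
Qed.

Lemma dist_fun_lt0 (dT : measure_display) (T : measurableType dT)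
    (P : probability T R) (V : T -> R) x : (forall w, 0 <= V w) -> x < 0 ->
  dist_fun P V x = 0.
Proof.
move=> V0 x0; rewrite /dist_fun (_ : [set w | _] = set0) ?measure0 //.
apply/seteqP; split=> w //= Vx.
by have := le_lt_trans (le_trans (V0 w) Vx) x0; rewrite ltxx.
Qed.

Let poly k M (y : R) := 1 - (1 - y ^+ k) ^+ M.

Let poly01 k M y : 0 <= y <= 1 -> 0 <= poly k M y <= 1.
Proof.
move=> /andP[y0 y1]; have yk0 : 0 <= y ^+ k by rewrite exprn_ge0.
have yk1 : y ^+ k <= 1 by rewrite exprn_ile1.
have a0 : 0 <= 1 - y ^+ k by rewrite subr_ge0.
have a1 : 1 - y ^+ k <= 1 by rewrite gerBl.
by rewrite /poly subr_ge0 gerBl exprn_ile1 // exprn_ge0.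
Qed.

Section one_space.
Context {dT : measure_display} {T : measurableType dT} (P : probability T R).
Variable V : T -> R.
Hypotheses (mV : measurable_fun setT V) (V0 : forall w, 0 <= V w).

Let Y01 w : 0 <= expR (- V w) <= 1.
Proof. by rewrite expR_ge0 expR_le1 oppr_le0 V0. Qed.

Lemma integrable_laplace (a : R) : 0 <= a ->
  P.-integrable setT (EFin \o (fun w => expR (- (a * V w)))).
Proof.
move=> a0; apply: (@integrable_boundr _ _ _ P _ 1) => [|w].
  do 2 (apply: measurableT_comp => //); exact: measurable_funM.
by rewrite ger0_norm ?expR_ge0 // expR_le1 oppr_le0 mulr_ge0.
Qed.

(** The binomial expansion leaves only Laplace transforms at the integers k i, which is why
    convergence at integers suffices. *)
Lemma Rintegral_threshold k M :
  \int[P]_w poly k M (expR (- V w)) = 1 - \sum_(i < M.+1)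
    ((-1) ^+ i *+ 'C(M, i)) * \int[P]_w expR (- ((k * i)%:R * V w)).
Proof.
have iS (i : 'I_M.+1) : P.-integrable setT (EFin \o
    (fun w => ((-1) ^+ i *+ 'C(M, i)) * expR (- ((k * i)%:R * V w)))).
  exact/integrable_scaler/integrable_laplace.
transitivity (\int[P]_w (1 - \sum_(i < M.+1)
    ((-1) ^+ i *+ 'C(M, i)) * expR (- ((k * i)%:R * V w)))).
  apply: eq_Rintegral => w _; rewrite /poly exprBn; congr (_ - _).
  apply: eq_bigr => i _; rewrite expr1n mulr1 -mulrnAl; congr (_ * _).
  by rewrite -exprM -expRM_natl mulrN.
rewrite RintegralB //; [|exact: integrable_cstr|exact: integrable_sumr].
rewrite Rintegral_cstr Rintegral_sumr //; congr (_ - _).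
by apply: eq_bigr => i _; rewrite RintegralZl //; exact: integrable_laplace.
Qed.

Lemma integrable_threshold k M :
  P.-integrable setT (EFin \o (fun w => poly k M (expR (- V w)))).
Proof.
apply: (@integrable_boundr _ _ _ P _ 1) => [|w].
  apply: measurable_funB => //; apply: measurable_funX.
  apply: measurable_funB => //; apply: measurable_funX.
  by do 2 (apply: measurableT_comp => //).
by case/andP: (poly01 k M (Y01 w)) => ? ?; rewrite ger0_norm.
Qed.

Let integrable_le_set x :
  P.-integrable setT (EFin \o (fun w => \1_[set w | V w <= x] w : R)).
Proof. exact: integrable_indic (measurable_le_set x mV). Qed.

(** V <= x means exp(- V) >= exp(- x), where the polynomial is nearly 1; where V > y it is nearly 0.
    Both bounds integrate these pointwise comparisons. *)
Lemma threshold_bounds k M (x y e : R) : 0 <= e ->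
  (forall u, 0 <= u <= 1 -> (u <= expR (- y) -> poly k M u <= e) /\
     (expR (- x) <= u -> 1 - e <= poly k M u)) ->
  dist_fun P V x <= \int[P]_w poly k M (expR (- V w)) + e /\
  \int[P]_w poly k M (expR (- V w)) <= dist_fun P V y + e.
Proof.
move=> e0 H; have iP := integrable_threshold k M.
have ie : P.-integrable setT (EFin \o (fun=> e)) by exact: integrable_cstr.
rewrite !dist_fun_Rintegral // -[e in leRHS](Rintegral_cstr P e).
rewrite -[in X in _ /\ X](Rintegral_cstr P e) -!RintegralD //.
split; (apply: le_Rintegral => //; first exact: integrable_addr) => w _.
  have [_ h2] := H _ (Y01 w); have /andP[p0 p1] := poly01 k M (Y01 w).
  rewrite indicE; have [wx|wx] := boolP (_ \in _); last by rewrite addr_ge0.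
  by rewrite inE /= in wx; have := h2; rewrite ler_expR lerN2 => /(_ wx) /=; lra.
have [h1 _] := H _ (Y01 w); have /andP[p0 p1] := poly01 k M (Y01 w).
rewrite indicE; have [wy|wy] := boolP (_ \in _); first by rewrite /=; lra.
rewrite add0r; apply: h1; rewrite ler_expR lerN2 ltW // ltNge.
by apply: contraNN wy => ?; rewrite inE.
Qed.

End one_space.

Context {dT : nat -> measure_display} {T : forall n, measurableType (dT n)}
  (P : forall n, probability (T n) R) (V_ : forall n, T n -> R)
  {dO : measure_display} {O : measurableType dO} (Q : probability O R)
  (V : O -> R).
Hypotheses (mV_ : forall n, measurable_fun setT (@V_ n))
  (V0_ : forall n w, 0 <= @V_ n w) (mV : measurable_fun setT V)
  (V0 : forall w, 0 <= V w).
Hypothesis laplaceV : forall m : nat,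
  \int[P n]_w expR (- (m%:R * @V_ n w)) @[n --> \oo]
    --> \int[Q]_w expR (- (m%:R * V w)).

Lemma cvg_threshold k M :
  \int[P n]_w poly k M (expR (- @V_ n w)) @[n --> \oo]
    --> \int[Q]_w poly k M (expR (- V w)).
Proof.
rewrite Rintegral_threshold //; under eq_fun do rewrite Rintegral_threshold //.
apply: cvgB; first exact: cvg_cst.
apply: cvg_big => [|i _]; first exact: add_continuous.
exact: cvgMl_tmp.
Qed.

(** The threshold is placed between exp(- y) and exp(- x); y > 0 makes exp(- y) < 1. The way from
    one distribution function to the other costs e/4 three times. *)
Lemma dist_fun_sandwich x y (e : R) : 0 <= x -> x < y -> 0 < e ->
  \forall n \near \oo,
    dist_fun (P n) (@V_ n) x <= dist_fun Q V y + e /\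
    dist_fun Q V x <= dist_fun (P n) (@V_ n) y + e.
Proof.
move=> x0 xy e0; have e4 : 0 < e / 4 by rewrite divr_gt0.
have y0 : 0 < y by exact: le_lt_trans xy.
have [||k [M H]] := @threshold_polynomial R (expR (- y)) (expR (- x)) (e / 4)
  (expR_gt0 _) _ _ e4.
- by rewrite expR_lt1 oppr_lt0.
- by rewrite ltr_expR ltrN2.
near=> n.
have [q1 q2] := threshold_bounds Q mV V0 (ltW e4) H.
have [p1 p2] := threshold_bounds (P n) (@mV_ n) (@V0_ n) (ltW e4) H.
have : `|\int[Q]_w poly k M (expR (- V w))
   - \int[P n]_w poly k M (expR (- @V_ n w))| <= e / 4.
  by near: n; exact: (cvgr_dist_le _ _ (@cvg_threshold k M) _ e4).
rewrite ler_norml => /andP[d1 d2]; split; lra.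
Unshelve. all: by end_near. Qed.

(** Continuity of the limit at [x] pays for the gap dl / 2 that the sandwich requires. Where the
    left point of the sandwich is negative, its distribution function vanishes by nonnegativity. *)
Lemma cvg_in_distribution_laplace :
  cvg_in_distribution (fun n => dist_fun (P n) (@V_ n)) (dist_fun Q V).
Proof.
move=> x cx; apply/cvgrPdist_le => e e0.
have e2 : 0 < e / 2 by rewrite divr_gt0.
have /cvgrPdist_le/(_ _ e2)[dl /= dl0 Hdl] := cx.
have near_x y : `|x - y| < dl -> `|dist_fun Q V x - dist_fun Q V y| <= e / 2.
  exact: Hdl.
have dl2 : `|dl / 2| < dl by rewrite ger0_norm; lra.
have Fhi : dist_fun Q V (x + dl / 2) <= dist_fun Q V x + e / 2.
  have := near_x (x + dl / 2); rewrite opprD addNKr normrN => /(_ dl2).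
  by rewrite ler_norml; lra.
have Flo : dist_fun Q V x - e / 2 <= dist_fun Q V (x - dl / 2).
  have := near_x (x - dl / 2); rewrite opprB addrC subrK => /(_ dl2).
  by rewrite ler_norml; lra.
have hi : \forall n \near \oo, dist_fun (P n) (@V_ n) x <= dist_fun Q V x + e.
  have [x0|x0] := ltP x 0.
    by near=> n; rewrite !dist_fun_lt0 // add0r ltW.
  have xd : x < x + dl / 2 by lra.
  near=> n; have [+ _] : dist_fun (P n) (@V_ n) x <= dist_fun Q V (x + dl / 2) + e / 2
      /\ dist_fun Q V x <= dist_fun (P n) (@V_ n) (x + dl / 2) + e / 2.
    by near: n; exact: dist_fun_sandwich.
  lra.
have lo : \forall n \near \oo, dist_fun Q V x <= dist_fun (P n) (@V_ n) x + e.
  have [x0|x0] := ltP (x - dl / 2) 0.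
    near=> n; have h := dist_fun_ge0 (P n) (@V_ n) x.
    by move: Flo; rewrite (dist_fun_lt0 _ V0 x0) => Flo; lra.
  have xd : x - dl / 2 < x by lra.
  near=> n; have [_ +] : dist_fun (P n) (@V_ n) (x - dl / 2) <= dist_fun Q V x + e / 2
      /\ dist_fun Q V (x - dl / 2) <= dist_fun (P n) (@V_ n) x + e / 2.
    by near: n; exact: dist_fun_sandwich.
  lra.
near=> n.
have h1 : dist_fun (P n) (@V_ n) x <= dist_fun Q V x + e by near: n.
have h2 : dist_fun Q V x <= dist_fun (P n) (@V_ n) x + e by near: n.
by rewrite ler_norml; apply/andP; split; lra.
Unshelve. all: by end_near. Qed.

End continuity_theorem.

(** * Continuity of distribution functions and uniform convergence *)

Section distribution_functions.
Context {R : realType}.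

(** The sets [B n] shrink to the null set V = x, so their probabilities tend to 0, and they bound
    the increments of the distribution function near [x]. *)
Lemma dist_fun_continuous (dO : measure_display) (O : measurableType dO)
    (Q : probability O R) (V : O -> R) : measurable_fun setT V ->
  (forall x, Q [set w | V w = x] = 0%E) -> continuous (dist_fun Q V).
Proof.
move=> mV V0.
suff cont (x : R) : dist_fun Q V y @[y --> x] --> dist_fun Q V x by exact: cont.
pose B (n : nat) := [set w | `|V w - x| <= n.+1%:R^-1].
have mB n : measurable (B n).
  by apply: (@measurable_le_set R _ _ (fun w => `|V w - x|));
    apply: measurableT_comp => //; exact: measurable_funB.
have capB : \bigcap_n B n = [set w | V w = x].
  apply/seteqP; split=> w /=; last by move=> Vw n _; rewrite /B /= Vw subrr normr0.
  move=> Bw; apply/eqP; rewrite -subr_eq0 -normr_eq0 eq_le normr_ge0 andbT.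
  apply/ler_addgt0Pl => e e0; rewrite addr0.
  have [n /ltW ne] := ltr_add_invr (e0 : 0 < e).
  by apply: le_trans (Bw n Logic.I) _; rewrite add0r in ne.
have QB : fine (Q (B n)) @[n --> \oo] --> (0 : R).
  apply: fine_cvg; rewrite (_ : 0%:E = Q (\bigcap_n B n)); last by rewrite capB V0.
  apply: (@nonincreasing_cvg_mu _ _ _ Q B) => //.
  - by rewrite (le_lt_trans (probability_le1 _ (mB 0%N))) ?ltry.
  - exact: bigcap_measurable.
  - move=> n m nm; apply/subsetPset => w /= /le_trans; apply.
    by rewrite lef_pV2 ?posrE // ler_nat.
have dist_le (y z : R) n :
    y <= z -> x - n.+1%:R^-1 <= y -> z <= x + n.+1%:R^-1 ->
    dist_fun Q V z <= dist_fun Q V y + fine (Q (B n)).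
  move=> yz xy zx.
  have mLy := measurable_le_set y mV; have mLz := measurable_le_set z mV.
  rewrite /dist_fun -fineD ?fin_num_measure //.
  apply: fine_le; rewrite ?fin_num_measure // ?fin_numD ?fin_num_measure //.
  apply: le_trans (measureU2 _ mLy (mB n)).
  apply: le_measure; rewrite ?inE //; first exact: measurableU.
  move=> w /= wz; have [wy|yw] := leP (V w) y; [by left|right].
  rewrite -[B n w]/(is_true (`|V w - x| <= n.+1%:R^-1)) ler_norml.
  apply/andP; split; first by rewrite lerBrDl; exact: le_trans xy (ltW yw).
  by rewrite lerBlDl; exact: le_trans wz zx.
apply/cvgrPdist_le => e e0.
have [n ne] : exists n, fine (Q (B n)) <= e.
  have := cvgr_le _ QB _ e0 => -[n _ /(_ n (leqnn n))] /=; by exists n.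
exists n.+1%:R^-1 => //= y /ltW; rewrite distrC ler_norml => /andP[y1 y2].
have mono := dist_fun_nondecreasing Q mV.
have [xy|yx] := leP x y.
  have h1 := mono _ _ xy; have n0 : 0 <= n.+1%:R^-1 :> R by [].
  have h2 : dist_fun Q V y <= dist_fun Q V x + fine (Q (B n)).
    by apply: dist_le => //; [rewrite lerBlDr lerDl|rewrite -lerBlDl].
  by rewrite ler_norml; apply/andP; split; lra.
have h1 := mono _ _ (ltW yx); have n0 : 0 <= n.+1%:R^-1 :> R by [].
have h2 : dist_fun Q V x <= dist_fun Q V y + fine (Q (B n)).
  by apply: dist_le; [exact: ltW|rewrite -lerBrDl|rewrite lerDl].
by rewrite ler_norml; apply/andP; split; lra.
Qed.

Lemma dist_fun_cvg1 (dO : measure_display) (O : measurableType dO)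
    (Q : probability O R) (V : O -> R) : measurable_fun setT V ->
  forall e, 0 < e -> exists x, 1 - e <= dist_fun Q V x.
Proof.
move=> mV e e0.
have H : dist_fun Q V n%:R @[n --> \oo] --> (1 : R).
  apply: fine_cvg; rewrite (_ : 1%:E = Q setT); last by rewrite probability_setT.
  have <- : \bigcup_n [set w | V w <= n%:R] = setT.
    rewrite -subTset => w _; exists (Num.truncn (V w)).+1 => //=.
    by rewrite ltW // truncnS_gt.
  apply: (@nondecreasing_cvg_mu _ _ _ Q (fun n => [set w | V w <= n%:R])).
  - by move=> n; exact: measurable_le_set.
  - by apply: bigcup_measurable => n _; exact: measurable_le_set.
  - move=> n m nm; apply/subsetPset => w /= /le_trans; apply.
    by rewrite ler_nat.
have e1 : 1 - e < 1 by rewrite gtrBl.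
have := cvgr_ge _ H _ e1 => -[n _ /(_ n (leqnn n))] /=; by exists n%:R.
Qed.

(* Pointwise convergence at the quantiles of order k/m suffices. *)
Lemma polya (F_ : nat -> R -> R) (F : R -> R) :
  (forall n, {homo F_ n : x y / x <= y}) -> (forall n x, 0 <= F_ n x <= 1) ->
  {homo F : x y / x <= y} -> (forall x, 0 <= F x <= 1) -> continuous F ->
  (exists x, F x = 0) -> (forall e, 0 < e -> exists x, 1 - e <= F x) ->
  (forall x, F_ n x @[n --> \oo] --> F x) -> cvg_sup_dist F_ F.
Proof.
move=> mF_ F_01 mF F01 cF [a Fa] F1 FF; apply/cvgrPdist_le => e e0.
pose m := (Num.truncn (3 / e)).+1.
have m0 : 0 < m%:R :> R by rewrite ltr0n.
have me : 3 / m%:R <= e.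
  by rewrite ler_pdivrMr // mulrC -ler_pdivrMr // ltW // truncnS_gt.
(* Only orders below 1: the value 0 is attained, while 1 may be approached without being
   attained. *)
have quantile (k : 'I_m) : exists x, F x = k%:R / m%:R.
  have km : k%:R / m%:R < 1 :> R by rewrite ltr_pdivrMr // mul1r ltr_nat.
  have [b Fb] := F1 (1 - k%:R / m%:R) (ltac:(by rewrite subr_gt0)).
  have k0 : 0 <= k%:R / m%:R :> R by rewrite divr_ge0.
  pose b' := Num.max a b.
  have ab : a <= b' by rewrite le_max lexx.
  have Fb' : k%:R / m%:R <= F b'.
    have : F b <= F b' by apply: mF; rewrite le_max lexx orbT.
    by lra.
  have [|c _ Fc] := IVT ab (v := k%:R / m%:R) (continuous_subspaceT cF).
    by rewrite ge_min le_max Fa k0 Fb' orbT.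
  by exists c.
have [q qE] := choice quantile.
near=> n.
have close (k : 'I_m) : `|F (q k) - F_ n (q k)| <= 1 / m%:R.
  move: k; near: n; apply: filter_forall => k.
  exact: (cvgr_dist_le _ _ (FF (q k)) _ (divr_gt0 ltr01 m0)).
have mi : 0 <= m%:R^-1 :> R by rewrite invr_ge0 ltW.
have dist x : `|F_ n x - F x| <= 3 / m%:R.
  have /andP[v0 v1] := F01 x; have /andP[u0 u1] := F_01 n x.
  pose k := Num.truncn (F x * m%:R).
  have klo : k%:R <= F x * m%:R by rewrite truncn_le // mulr_ge0.
  have khi : F x * m%:R < k%:R + 1 by rewrite natr1 truncnS_gt.
  have hi : F_ n x <= F x + 3 / m%:R.
    have [km|km] := ltnP k.+1 m.
      have h := close (Ordinal km); have := qE (Ordinal km); set y := q _ => yE.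
      have xy : x <= y.
        rewrite leNgt; apply/negP => /ltW/mF; rewrite yE /= ler_pdivrMr //.
        by rewrite -natr1; lra.
      have := mF_ n _ _ xy; move: h; rewrite -/y yE /= ler_norml -natr1.
      move=> /andP[h _] h'.
      have : k%:R / m%:R <= F x by rewrite ler_pdivrMr.
      by move: h h'; lra.
    apply: le_trans u1 _; rewrite -lerBlDr -(ler_pM2r m0) mulrBl divfK ?gt_eqF //.
    have : m%:R <= k.+1%:R :> R by rewrite ler_nat.
    by rewrite -natr1; lra.
  (* The quantile one below [k] is taken: its order is strictly less than F x, which places it to
     the left of x, and its index is below m even if F x = 1. The loss is two cells plus 1/m, hence
     the 3. *)
  have lo : F x - 3 / m%:R <= F_ n x.
    case: k klo khi => [|[|k]] klo khi.
    - apply: le_trans u0; rewrite subr_le0 ler_pdivlMr //; lra.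
    - apply: le_trans u0; rewrite subr_le0 ler_pdivlMr //; lra.
    - have km : (k.+1 < m)%N.
        rewrite -(ltr_nat R); apply: lt_le_trans (_ : F x * m%:R <= _).
          by move: klo; rewrite -[k.+2%:R]natr1; lra.
        by rewrite -[leRHS]mul1r ler_pM2r.
      have h := close (Ordinal km); have := qE (Ordinal km); set y := q _ => yE.
      have yx : y <= x.
        rewrite leNgt; apply/negP => /ltW/mF; rewrite yE /= ler_pdivlMr //.
        by move: klo; rewrite -[k.+2%:R]natr1; lra.
      have := mF_ n _ _ yx; move: h; rewrite -/y yE /= ler_norml.
      move=> /andP[_ h] h'.
      have : F x <= (k.+2%:R + 1) / m%:R by rewrite ler_pdivlMr // ltW.
      by move: h; rewrite -[k.+2%:R]natr1 -[k.+1%:R]natr1; lra.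
  by rewrite ler_norml; apply/andP; split; lra.
have ub : ubound (range (fun x => `|F_ n x - F x|)) e.
  by move=> _ [x _ <-]; exact: le_trans (dist x) me.
rewrite sub0r normrN ger0_norm.
  by apply: ge_sup => //; exists (`|F_ n 0 - F 0|); exists 0.
apply: le_trans (normr_ge0 (F_ n 0 - F 0)) _.
by apply: ub_le_sup; [exists e|exists 0].
Unshelve. all: by end_near. Qed.

End distribution_functions.

(** * The limit variable *)

Lemma char_poly_orthogonal_conj (R : comUnitRingType) n (O A : 'M[R]_n) :
  O *m O^T = 1%:M -> char_poly (O *m A *m O^T) = char_poly A.
Proof.
move=> OO; have PP : map_mx polyC O *m map_mx polyC O^T = 1%:M.
  by rewrite -map_mxM OO map_scalar_mx.
rewrite /char_poly; have -> : char_poly_mx (O *m A *m O^T) =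
    map_mx polyC O *m char_poly_mx A *m map_mx polyC O^T.
  rewrite /char_poly_mx mulmxBr mulmxBl !map_mxM; congr (_ - _).
  by rewrite mul_mx_scalar -scalemxAl PP scalemx1.
by rewrite !det_mulmx mulrAC -det_mulmx PP det1 mul1r.
Qed.

Section spectrum.
Context {R : realType} {d : nat}.
Implicit Types (A O : 'M[R]_d) (lambda mu : 'I_d -> R).

Lemma eigenvalues_diag A O (D : 'rV[R]_d) :
  O *m O^T = 1%:M -> O *m A *m O^T = diag_mx D -> eigenvalues A (D ord0).
Proof.
move=> OO OAO; rewrite /eigenvalues -(char_poly_orthogonal_conj A OO) OAO.
rewrite char_poly_trig ?diag_mx_is_trig //.
by apply: eq_bigr => i _; rewrite mxE eqxx.
Qed.

Lemma eigenvalues_sub A lambda mu : eigenvalues A lambda -> eigenvalues A mu ->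
  forall i, exists j, lambda i = mu j.
Proof.
rewrite /eigenvalues => -> e i; have : (\prod_j ('X - (mu j)%:P)).[lambda i] == 0.
  by rewrite -e horner_prod (bigD1 i) //= hornerXsubC subrr mul0r.
rewrite horner_prod => /eqP/eqP; rewrite prodf_seq_eq0 => /hasP[j _ /=].
by rewrite hornerXsubC subr_eq0 => /eqP ->; exists j.
Qed.

(** For s <> 0 the product is (- s)^d times the characteristic polynomial at - 1/s. This compares
    two lists of eigenvalues without constructing a permutation. *)
Lemma eigenvalues_prod1D A lambda mu (s : R) :
  eigenvalues A lambda -> eigenvalues A mu ->
  \prod_i (1 + s * lambda i) = \prod_i (1 + s * mu i).
Proof.
rewrite /eigenvalues => el em; have [->|s0] := eqVneq s 0.
  by under eq_bigr do rewrite mul0r; under [RHS]eq_bigr do rewrite mul0r.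
have E (nu : 'I_d -> R) : \prod_i (1 + s * nu i) =
    (- s) ^+ d * (\prod_i ('X - (nu i)%:P)).[- s^-1].
  have -> : (- s) ^+ d = \prod_(i < d) (- s) by rewrite prodr_const card_ord.
  rewrite horner_prod.
  elim/big_rec3 : _ => [|i a b c _ ->]; first by rewrite mulr1.
  by rewrite hornerXsubC; field.
by rewrite !E -em -el.
Qed.

Lemma sum_ln (x : 'I_d -> R) : (forall i, 0 < x i) ->
  \sum_i ln (x i) = ln (\prod_i x i).
Proof.
move=> x0; suff [] : \sum_i ln (x i) = ln (\prod_i x i) /\ 0 < \prod_i x i by [].
elim/big_rec2 : _ => [|i p q _ [-> p0]]; first by rewrite ln1.
by rewrite lnM ?posrE // mulr_gt0.
Qed.

End spectrum.

Section weighted_chi2.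
Context {R : realType} {d : nat} {dO : measure_display}
  {Om : measurableType dO} (Q : probability Om R) (N : 'I_d -> {RV Q >-> R})
  (lambda : 'I_d -> R).
Hypotheses (iidN : iid N) (stdN : forall i, standard_normal (N i)).
Hypothesis lambda0 : forall i, 0 <= lambda i.

Let V w : R := \sum_(i < d) lambda i * N i w ^+ 2.

Let mterm (c : 'I_d -> R) i : measurable_fun setT (fun x : R => c i * x ^+ 2).
Proof. by apply: measurable_funM. Qed.

Lemma measurable_chi2 : measurable_fun setT V.
Proof.
apply: measurable_sum => i.
exact: (measurableT_comp (mterm lambda i) (measurable_funP (N i))).
Qed.

Lemma chi2_ge0 w : 0 <= V w.
Proof. by apply: sumr_ge0 => i _; rewrite mulr_ge0 ?sqr_ge0. Qed.

Lemma laplace_chi2 (s : R) : 0 <= s ->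
  \int[Q]_w expR (- (s / 2 * V w)) =
  expR (- (\sum_i ln (1 + s * lambda i) / 2)).
Proof.
move=> s0; pose c i := s * lambda i / 2.
have c0 i : 0 <= c i by rewrite !mulr_ge0.
have := laplace_sum_outside (g := fun i (x : R) => c i * x ^+ 2) iidN.1
  (mterm c) finset.set0.
move=> /(_ (fun i (x : R) => mulr_ge0 (c0 i) (sqr_ge0 x))) e.
transitivity (\int[Q]_w expR (- sum_outside N (mterm c) finset.set0 w)).
  apply: eq_Rintegral => w _; congr (expR (- _)); rewrite /= finset.setC0 mulr_sumr.
  by apply: eq_big => [i|i _]; rewrite ?inE // /c; ring.
rewrite e finset.setC0 -sumrN expR_sum.
apply: eq_big => [i|i _]; first by rewrite inE.
by rewrite laplace_normal_square // mulr_ge0.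
Qed.

(** Given the value a of the other terms, N_i0^2 is determined, so N_i0 lies in a set of at most two
    points, which is null for the normal law. *)
Lemma chi2_no_atom i0 : 0 < lambda i0 -> forall x, Q [set w | V w = x] = 0%E.
Proof.
move=> l0 x.
pose S := sum_outside N (mterm lambda) [set i0]%SET.
have VE w : V w = S w + lambda i0 * N i0 w ^+ 2.
  rewrite /S /= /V (bigD1 i0) //= addrC; congr (_ + _).
  by apply: eq_bigl => i; rewrite !inE.
have ind := independent_sum_outside iidN.1 (mterm lambda) [set i0]%SET.
pose C := [set z : R * R | z.1 + lambda i0 * z.2 ^+ 2 = x].
have mop : measurable_fun setT (fun z : R * R => z.1 + lambda i0 * z.2 ^+ 2).
  apply: measurable_funD => //.
  exact: (measurableT_comp (mterm lambda i0) measurable_snd).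
have mC : measurable C.
  rewrite -[C]setTI; exact: (mop measurableT [set x] (measurable_set1 x)).
have i0J : i0 \in [set i0]%SET by rewrite inE.
have -> : [set w | V w = x] = (fun w => (S w, N i0 w)) @^-1` C.
  by apply/seteqP; split=> w /=; rewrite VE.
rewrite (independent_of_pair ind i0J mC).
rewrite /product_measure1 /=; apply: integral0_eq => a _ /=.
set B := xsection C a.
have mB : measurable B by exact: measurable_xsection.
rewrite -[LHS]/(distribution Q (N i0) B) stdN //.
apply: ((null_content_dominatesP _ _).1 (normal_prob_dominates (0 : R) 1)) => //.
apply: countable_lebesgue_measure0; apply: finite_set_countable.
pose r := Num.sqrt ((x - a) / lambda i0).
apply: (@sub_finite_set _ _ [set r; - r]); last exact: finite_set2.
move=> u; rewrite /B /xsection /= inE /C /= => e.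
have -> : r = `|u|.
  rewrite /r -e addrAC subrr add0r mulrC mulKf ?gt_eqF // sqrtr_sqr //.
by case: (ger0P u) => _; [left|right; rewrite opprK].
Qed.

End weighted_chi2.

Lemma row_stat_ge0 (R : realType) d T n (X : nat -> T -> 'rV[R]_d) w :
  0 <= row_stat n X w.
Proof. by rewrite mulr_ge0 ?sqr_ge0. Qed.

(** [row_statE] with the identity as rotation; it assumes n > 0, so the empty row is treated
    apart. *)
Lemma measurable_row_stat (R : realType) d (dT : measure_display)
    (T : measurableType dT) (P : probability T R) n
    (X : nat -> {RV P >-> borel_rV R d}) :
  measurable_fun setT (row_stat n (fun i => X i)).
Proof.
have [->|n0] := posnP n.
  rewrite (_ : row_stat _ _ = cst 0); first exact: measurable_cst.
  by apply/funext => w; rewrite /row_stat mul0r.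
have OO : 1%:M *m 1%:M^T = 1%:M :> 'M[R]_d by rewrite trmx1 mulmx1.
rewrite (_ : row_stat _ _ =
  fun w => \sum_j tnth (partial_sum n X 1%:M n w) j ^+ 2); last first.
  by apply/funext => w; exact: row_statE.
apply: measurable_sum => j; apply: measurable_funX.
exact: (measurableT_comp (measurable_tnth j) (measurable_partial_sum n X 1%:M n)).
Qed.

(** For Gamma = 0 the limit is V = 0 and F jumps at 0. There V_n may be almost surely positive, so
    the supremum can stay at 1; this is why the equivalence is stated for Gamma <> 0. *)
Theorem lemma1 (R : realType) (d : nat) (hd : (0 < d)%N) (Gamma : 'M[R]_d)
    (dT : nat -> measure_display) (T : forall n, measurableType (dT n))
    (P : forall n, probability (T n) R)
    (X : forall n, nat -> {RV P n >-> borel_rV R d})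
    (hiid : forall n, (0 < n)%N -> iid (fun i : 'I_n => X n i.+1))
    (hmean : forall n, (0 < n)%N ->
       forall j : 'I_d, 'E_(P n)[rv_coord (X n 1%N) j]%E = 0%E)
    (hmom2 : forall n, (0 < n)%N ->
       ('E_(P n)[fun w => (enorm (X n 1%N w) ^+ 2)%R] < +oo)%E)
    (hcov : forall j k : 'I_d,
       cov_mx (P n) (X n 1%N) j k @[n --> \oo] --> Gamma j k)
    (hlind : forall eps : rat, 0 < eps ->
       truncated_moment2 (P n) (X n 1%N) (Num.sqrt n%:R * ratr eps)
         @[n --> \oo] --> 0%E) :
  (exists lambda : 'I_d -> R, eigenvalues Gamma lambda) /\
  forall lambda : 'I_d -> R, eigenvalues Gamma lambda ->
  forall (dO : measure_display) (O : measurableType dO) (Q : probability O R)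
    (N : 'I_d -> {RV Q >-> R}),
  iid N -> (forall i, standard_normal (N i)) ->
  let F_ n := dist_fun (P n) (row_stat n (fun i => X n i)) in
  let F := dist_fun Q (fun w => \sum_(i < d) lambda i * N i w ^+ 2) in
  cvg_in_distribution F_ F /\
  (Gamma != 0 -> (cvg_in_distribution F_ F <-> cvg_sup_dist F_ F)).
Proof.
have [B [D [OO OGO]]] := symmetric_spectral (limit_cov_symmetric hcov).
have eigD := eigenvalues_diag OO OGO.
split; first by exists (D ord0).
move=> lambda eigl dO Om Q N iidN stdN F_ F.
have D0 := limit_cov_diag_ge0 hmean hmom2 hcov OGO.
have l0 i : 0 <= lambda i by have [j ->] := eigenvalues_sub eigl eigD i.
have mV := measurable_chi2 N lambda.
have V0 := chi2_ge0 N l0.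
have lnE (s : R) : 0 <= s ->
  \sum_i ln (1 + s * lambda i) / 2 = \sum_i ln (1 + s * D ord0 i) / 2.
  move=> s0; rewrite -!mulr_suml !sum_ln ?(eigenvalues_prod1D s eigl eigD) //.
    by move=> i; rewrite ltr_wpDr ?mulr_ge0.
  by move=> i; rewrite ltr_wpDr ?mulr_ge0.
have cvgF : cvg_in_distribution F_ F.
  apply: cvg_in_distribution_laplace => //.
  - by move=> n; exact: measurable_row_stat.
  - by move=> n w; exact: row_stat_ge0.
  (* The transforms carry s / 2, so s = 2 m gives the integer argument m. *)
  - move=> m; have s0 : 0 <= 2 * m%:R :> R by rewrite mulr_ge0.
    have := row_laplace_cvg hiid hmean hmom2 hcov hlind OO OGO s0.
    have e2 : 2 * m%:R / 2 = m%:R :> R by rewrite mulrAC divff ?mul1r.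
    rewrite -lnE // -(laplace_chi2 iidN stdN l0 s0) e2; exact.
split=> // G0; split=> // _.
(* Otherwise all eigenvalues vanish; then D = 0, and undoing the rotation gives Gamma = 0. *)
have [i li] : exists i, 0 < lambda i.
  apply: contrapT => /forallNP nl; move/eqP: G0; apply.
  have Dz : diag_mx D = 0.
    apply/matrixP => j k; rewrite !mxE; have [jE ->] := eigenvalues_sub eigD eigl j.
    have := nl jE; move/negP; rewrite -leNgt => lj.
    have -> : lambda jE = 0 by apply/eqP; rewrite eq_le lj l0.
    by rewrite mul0rn.
  have OO' := mulmx1C OO.
  have -> : Gamma = B^T *m (B *m Gamma *m B^T) *m B.
    by rewrite !mulmxA OO' mul1mx -mulmxA OO' mulmx1.
  by rewrite OGO Dz mulmx0 mul0mx.
have cF : continuous F.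
  exact: dist_fun_continuous mV (chi2_no_atom iidN stdN li).
apply: polya => //.
- by move=> n; apply: dist_fun_nondecreasing; exact: measurable_row_stat.
- move=> n x; rewrite dist_fun_ge0 dist_fun_le1 //; exact: measurable_row_stat.
- exact: dist_fun_nondecreasing.
- by move=> x; rewrite dist_fun_ge0 dist_fun_le1.
- by exists (-1); apply: dist_fun_lt0.
- exact: dist_fun_cvg1.
- by move=> x; apply: cvgF; exact: cF.
Qed.
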